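(* Let $\psi$ be a Ma-Minda function, let $r_*$ be the Koebe-radius for the class $\mathcal{S}^*(\psi)$, and let $$f_0(z)=z\exp\int_0^z\frac{\psi(t)-1}{t}\,dt=z+\sum_{n=2}^\infty t_nz^n,\qquad \hat f_0(r)=r+\sum_{n=2}^\infty|t_n|r^n.$$ Fix $f\in\mathcal{S}^*(\psi)$, put $\Omega=f(\mathbb{D})$, and let $g(z)=\sum_{k=1}^\infty b_kz^k\in S_f(\psi)$. Then $S_f(\psi)$ satisfies the Bohr-phenomenon $$\sum_{k=1}^\infty|b_k|r^k\le d(f(0),\partial\Omega)\quad\text{for }|z|=r\le r_b,$$ where $r_b=\min\{r_0,1/3\}$ and $r_0$ is the least positive root of the equation $\hat f_0(r)=r_*$.
   Context: $\mathbb{D}=\{z:|z|<1\}$. $\mathcal{A}$ is the class of analytic functions $f(z)=z+\sum_{k\ge2}a_kz^k$ in $\mathbb{D}$. $\prec$ denotes subordination. A Ma-Minda function is a function $\psi$ analytic and univalent in $\mathbb{D}$ with $\Re\psi(z)>0$, $\psi(0)=1$, $\psi'(0)>0$ and $\psi(\mathbb{D})$ symmetric about the real axis. $\mathcal{S}^*(\psi)=\{f\in\mathcal{A}:zf'(z)/f(z)\prec\psi(z)\}$. For fixed $f\in\mathcal{S}^*(\psi)$, $S_f(\psi)=\{g(z)=\sum_{k\ge1}b_kz^k \text{ analytic in }\mathbb{D}: g\prec f\}$. The Koebe-radius $r_*$ of $\mathcal{S}^*(\psi)$ is the radius of the largest disk centred at $0$ contained in $f(\mathbb{D})$ for every $f\in\mathcal{S}^*(\psi)$;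 it is $r_*=-f_0(-1)$, understood as $\lim_{r\to1^-}(-f_0(-r))$. $d(\cdot,\partial\Omega)$ is the Euclidean distance to the boundary of $\Omega$. *)

(* Defs.v *)
(* Stdlib reals with Coquelicot's complex numbers C. *)
From Stdlib Require Import Reals.
From Coquelicot Require Import Coquelicot.

Open Scope R_scope.

(* All functions on the open unit disk D are total functions C -> C; only their
   values on D matter. *)

Definition in_disk (z : C) : Prop := Cmod z < 1.

Definition image_disk (f : C -> C) (w : C) : Prop :=
  exists z : C, in_disk z /\ f z = w.

Definition is_Cpseries (a : nat -> C) (z s : C) : Prop :=
  @is_pseries C_AbsRing C_NormedModule a z s.

Definition analytic_at (f : C -> C) (z0 : C) : Prop :=
  exists a : nat -> C,
    @locally C_UniformSpace z0 (fun z : C => is_Cpseries a (z - z0)%C (f z)).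

Definition analytic_on_disk (f : C -> C) : Prop :=
  forall z0 : C, in_disk z0 -> analytic_at f z0.

Definition expansion_on_disk (f : C -> C) (a : nat -> C) : Prop :=
  forall z : C, in_disk z -> is_Cpseries a z (f z).

Definition class_A (f : C -> C) : Prop :=
  analytic_on_disk f /\
  exists a : nat -> C,
    a 0%nat = RtoC 0 /\ a 1%nat = RtoC 1 /\ expansion_on_disk f a.

Definition univalent_on_disk (f : C -> C) : Prop :=
  forall z1 z2 : C, in_disk z1 -> in_disk z2 -> f z1 = f z2 -> z1 = z2.

Definition subordinate (g f : C -> C) : Prop :=
  exists w : C -> C,
    analytic_on_disk w /\
    w (RtoC 0) = RtoC 0 /\
    (forall z : C, in_disk z -> in_disk (w z)) /\
    (forall z : C, in_disk z -> g z = f (w z)).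

Definition ma_minda (psi : C -> C) : Prop :=
  analytic_on_disk psi /\
  univalent_on_disk psi /\
  (forall z : C, in_disk z -> 0 < Re (psi z)) /\
  psi (RtoC 0) = RtoC 1 /\
  (* psi'(0) is real and positive *)
  (Im (C_derive psi (RtoC 0)) = 0 /\ 0 < Re (C_derive psi (RtoC 0))) /\
  (forall w : C, image_disk psi w -> image_disk psi (Cconj w)).

(* z f'(z) / f(z), with its removable singularity at 0 filled in.  Elsewhere a
   zero of f gives the value 0 (as x / 0 = 0 in C), which is never a value of a
   psi with positive real part, so it cannot create spurious members of
   S_star. *)
Definition zdlog (f : C -> C) (z : C) : C :=
  if Ceq_dec z (RtoC 0) then RtoC 1 else (z * C_derive f z / f z)%C.

Definition S_star (psi f : C -> C) : Prop :=
  class_A f /\ subordinate (zdlog f) psi.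

Definition S_sub (f g : C -> C) : Prop :=
  analytic_on_disk g /\
  (exists b : nat -> C, b 0%nat = RtoC 0 /\ expansion_on_disk g b) /\
  subordinate g f.

Definition Cexp (z : C) : C :=
  (exp (Re z) * cos (Im z), exp (Re z) * sin (Im z)).

(* The integral from 0 to z is taken along the segment t = s z, 0 <= s <= 1;
   the value of the integrand at the single point s = 0 is irrelevant. *)
Definition f0 (psi : C -> C) (z : C) : C :=
  (z * Cexp (@RInt C_R_CompleteNormedModule
               (fun s : R => (psi (RtoC s * z) - RtoC 1) / (RtoC s * z) * z)
               0 1))%C.

Definition covers_disk (psi : C -> C) (rho : R) : Prop :=
  forall f : C -> C, S_star psi f ->
  forall w : C, Cmod w < rho -> image_disk f w.

Definition is_koebe_radius (psi : C -> C) (rho : R) : Prop :=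
  covers_disk psi rho /\
  forall rho' : R, covers_disk psi rho' -> rho' <= rho.

(* sum over n of |a_n| r^n *)
Definition converges_abs (a : nat -> C) (r : R) : Prop :=
  ex_pseries (fun n => Cmod (a n)) r.

Definition abs_sum (a : nat -> C) (r : R) : R :=
  PSeries (fun n => Cmod (a n)) r.

Definition is_positive_root (a : nat -> C) (v r : R) : Prop :=
  0 < r /\ converges_abs a r /\ abs_sum a r = v.

Definition is_least_positive_root (a : nat -> C) (v r : R) : Prop :=
  is_positive_root a v r /\
  forall r' : R, is_positive_root a v r' -> r <= r'.

Definition boundary (Omega : C -> Prop) (w : C) : Prop :=
  forall eps : R, 0 < eps ->
    (exists u : C, Omega u /\ Cmod (u - w)%C < eps) /\
    (exists u : C, ~ Omega u /\ Cmod (u - w)%C < eps).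

(* Extended-real valued: the infimum over an empty boundary is p_infty. *)
Definition dist_to_boundary (c : C) (Omega : C -> Prop) : Rbar :=
  Glb_Rbar (fun d : R => exists w : C, boundary Omega w /\ d = Cmod (w - c)%C).

(* Main.v *)
Require Import Defs.
From Stdlib Require Import Reals Lra Lia Factorial.
From Coquelicot Require Import Coquelicot.

Open Scope R_scope.

(** Write [psi = 1 + z Q], [F = f0 / z] and [G = f / z], and let a hat denote the
    majorant series, with [|a_n|] in place of [a_n].  The definition of [f0] says
    [F' = Q F].  If [z f' / f = psi(w)] with the Schwarz function [w = z om],
    then [G' = Q(w) om G].

    The core of the proof is that [G^(r) <= F^(r)] for [r <= 1/3].  Solving the two
    equations gives [G = F(w) R] with [R = exp(- int Q(w) z om')], hence
    [G' = F'(w) om R].  Caratheodory's inequality bounds the coefficients of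
    [Q] by 2, because [Re psi > 0], and the coefficients of [om] of positive
    index by [2 (1 - |om_0|)], because [|om| <= 1].  For [r <= 1/3] the second bound
    gives [mu := om^(r) <= 1], and the first one makes the majorant of [z Q(w)] at
    most 1.  Hence the majorant of [log R] is at most
    [v := sum j / (j+1) |om_j| r^j], where the factor [j / (j+1)] comes from the
    integration.  With [x := sum j |om_j| r^j] one has [v <= 1] and [v <= x/2],
    so that [R^ <= exp v <= 1 + 2 v <= 1 + x].
    For [u := w^(r) = r mu] this reads

      [G^' <= F^'(u) mu (1 + x) <= F^'(u) (mu + x) = (F^(u))'],

    since [mu <= 1] and [u' = mu + x].  Integration from 0 yields
    [G^(r) <= F^(u(r)) <= F^(r)].  This is [abs_sum_comparison].

    The rest is Bohr's principle and the Koebe radius.  A function [g]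
    subordinate to [f] is [f(w2)] for another Schwarz function, and
    [g^ <= f^(w2^) <= f^] up to [1/3] because [w2^(r) <= r] there
    ([maj_subordinate]).  So for [r <= min (r0, 1/3)] the majorant of [g] is at most
    [f^(r) = r G^(r) <= r F^(r) = f0^(r) <= f0^(r0) = rstar]
    ([maj_starlike]), and every boundary point of
    the image of [f] has modulus at least [rstar] ([koebe_le_dist]).

    Caratheodory's inequality itself rests on Cauchy's theorem in the form
    [mean_constant]: the mean of a holomorphic function over the circle of radius
    [r] does not depend on [r].  It is applied to functions with a pole at 0, which
    gives the Taylor coefficients at 0 of a function known to be analytic on the
    disk as means over any circle ([mean_coef]). *)

(** * Finite sums and limits of complex sequences *)

Fixpoint csum (u : nat -> C) (N : nat) : C :=
  match N with O => RtoC 0 | S n => (csum u n + u n)%C end.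

Fixpoint rsum (u : nat -> R) (N : nat) : R :=
  match N with O => 0 | S n => rsum u n + u n end.

Lemma csum_S (u : nat -> C) (N : nat) : csum u (S N) = (csum u N + u N)%C.
Proof. reflexivity. Qed.

Lemma rsum_S (u : nat -> R) (N : nat) : rsum u (S N) = rsum u N + u N.
Proof. reflexivity. Qed.

Lemma csum_ext (u v : nat -> C) (N : nat) :
  (forall n, (n < N)%nat -> u n = v n) -> csum u N = csum v N.
Proof.
  induction N as [|N IH]; intros H; simpl; auto.
  rewrite IH by (intros; apply H; lia). rewrite H by lia. reflexivity.
Qed.

Lemma csum_scal (c : C) (u : nat -> C) (N : nat) :
  csum (fun n => c * u n)%C N = (c * csum u N)%C.
Proof. induction N as [|N IH]; simpl; [ring|rewrite IH; ring]. Qed.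

Lemma csum_plus (u v : nat -> C) (N : nat) :
  csum (fun n => u n + v n)%C N = (csum u N + csum v N)%C.
Proof. induction N as [|N IH]; simpl; [ring|rewrite IH; ring]. Qed.

Lemma csum_shift (u : nat -> C) (N : nat) :
  csum u (S N) = (u 0%nat + csum (fun n => u (S n)) N)%C.
Proof.
  induction N as [|N IH]; [simpl; ring|].
  change (csum u (S (S N))) with (csum u (S N) + u (S N))%C.
  rewrite IH. simpl. ring.
Qed.

Lemma csum_switch (u : nat -> nat -> C) (N M : nat) :
  csum (fun i => csum (u i) M) N = csum (fun j => csum (fun i => u i j) N) M.
Proof.
  induction N as [|N IH]; simpl.
  - induction M; simpl; [reflexivity|]. rewrite <- IHM. ring.
  - rewrite IH, <- csum_plus. reflexivity.
Qed.

Lemma rsum_ext (u v : nat -> R) (N : nat) :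
  (forall n, (n < N)%nat -> u n = v n) -> rsum u N = rsum v N.
Proof.
  induction N as [|N IH]; intros H; simpl; auto.
  rewrite IH by (intros; apply H; lia). rewrite H by lia. reflexivity.
Qed.

Lemma rsum_le (u v : nat -> R) (N : nat) :
  (forall n, (n < N)%nat -> u n <= v n) -> rsum u N <= rsum v N.
Proof.
  induction N as [|N IH]; intros H; simpl; [lra|].
  apply Rplus_le_compat; [apply IH; intros; apply H; lia| apply H; lia].
Qed.

Lemma rsum_pos (u : nat -> R) (N : nat) :
  (forall n, 0 <= u n) -> 0 <= rsum u N.
Proof. intros H; induction N; simpl; [lra|]. specialize (H N). lra. Qed.

Lemma rsum_scal (c : R) (u : nat -> R) (N : nat) :
  rsum (fun n => c * u n) N = c * rsum u N.
Proof. induction N as [|N IH]; simpl; [ring|rewrite IH; ring]. Qed.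

Lemma rsum_shift (u : nat -> R) (N : nat) :
  rsum u (S N) = u 0%nat + rsum (fun n => u (S n)) N.
Proof.
  induction N as [|N IH]; [simpl; ring|].
  change (rsum u (S (S N))) with (rsum u (S N) + u (S N)).
  rewrite IH. simpl. ring.
Qed.

Lemma Cmod_csum (u : nat -> C) (N : nat) :
  Cmod (csum u N) <= rsum (fun n => Cmod (u n)) N.
Proof.
  induction N as [|N IH]; simpl; [rewrite Cmod_0; lra|].
  eapply Rle_trans; [apply Cmod_triangle|]. lra.
Qed.

Lemma rsum_sum_n (u : nat -> R) (N : nat) : rsum u (S N) = sum_n u N.
Proof.
  induction N as [|N IH].
  - rewrite sum_O. simpl. ring.
  - rewrite sum_Sn, <- IH. reflexivity.
Qed.

Lemma csum_sum_n (u : nat -> C) (N : nat) :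
  csum u (S N) = @sum_n C_AbelianMonoid u N.
Proof.
  induction N as [|N IH].
  - rewrite sum_O. simpl. ring.
  - rewrite sum_Sn, <- IH. reflexivity.
Qed.

Definition clim (u : nat -> C) (l : C) : Prop :=
  forall eps, 0 < eps ->
  exists N, forall n, (N <= n)%nat -> Cmod (u n - l)%C < eps.

Lemma clim_unique (u : nat -> C) (l l' : C) : clim u l -> clim u l' -> l = l'.
Proof.
  intros H H'. destruct (Ceq_dec l l') as [E|E]; auto. exfalso.
  assert (Hd : 0 < Cmod (l - l')%C).
  { apply Cmod_gt_0. intros E0. apply E.
    replace l with (l - l' + l')%C by ring. rewrite E0. ring. }
  destruct (H (Cmod (l - l')%C / 2)) as [N HN]; [lra|].
  destruct (H' (Cmod (l - l')%C / 2)) as [N' HN']; [lra|].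
  specialize (HN (N + N')%nat ltac:(lia)). specialize (HN' (N + N')%nat ltac:(lia)).
  assert (Cmod (l - l')%C <= Cmod (u (N + N')%nat - l)%C + Cmod (u (N + N')%nat - l')%C).
  { rewrite <- (Cmod_opp (u (N + N')%nat - l)%C).
    eapply Rle_trans; [|apply Cmod_triangle]. apply Req_le. f_equal. ring. }
  lra.
Qed.

Lemma clim_ext (u v : nat -> C) (l : C) :
  (forall n, u n = v n) -> clim u l -> clim v l.
Proof.
  intros E H eps He. destruct (H eps He) as [N HN]. exists N.
  intros n Hn. rewrite <- E. auto.
Qed.

Lemma clim_plus (u v : nat -> C) (l m : C) :
  clim u l -> clim v m -> clim (fun n => u n + v n)%C (l + m)%C.
Proof.
  intros H H' eps He.
  destruct (H (eps / 2)) as [N HN]; [lra|].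
  destruct (H' (eps / 2)) as [N' HN']; [lra|].
  exists (N + N')%nat. intros n Hn.
  specialize (HN n ltac:(lia)). specialize (HN' n ltac:(lia)).
  replace (u n + v n - (l + m))%C with ((u n - l) + (v n - m))%C by ring.
  eapply Rle_lt_trans; [apply Cmod_triangle|]. lra.
Qed.

Lemma clim_scal (c : C) (u : nat -> C) (l : C) :
  clim u l -> clim (fun n => c * u n)%C (c * l)%C.
Proof.
  intros H eps He.
  assert (Hc := Cmod_ge_0 c).
  destruct (H (eps / (Cmod c + 1))) as [N HN].
  { apply Rdiv_lt_0_compat; lra. }
  exists N. intros n Hn. specialize (HN n Hn).
  replace (c * u n - c * l)%C with (c * (u n - l))%C by ring.
  rewrite Cmod_mult.
  apply (Rmult_lt_compat_r (Cmod c + 1)) in HN; [|lra].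
  replace (eps / (Cmod c + 1) * (Cmod c + 1)) with eps in HN by (field; lra).
  assert (H0 := Cmod_ge_0 (u n - l)%C). nra.
Qed.

Lemma clim_const (c : C) : clim (fun _ => c) c.
Proof.
  intros eps He. exists O. intros. replace (c - c)%C with (RtoC 0) by ring.
  rewrite Cmod_0. exact He.
Qed.

Lemma clim_shift (u : nat -> C) (k : nat) (l : C) :
  clim (fun n => u (n - k)%nat) l <-> clim u l.
Proof.
  split; intros H eps He; destruct (H eps He) as [N HN].
  - exists N. intros n Hn. specialize (HN (n + k)%nat ltac:(lia)).
    replace (n + k - k)%nat with n in HN by lia. exact HN.
  - exists (N + k)%nat. intros n Hn. apply HN. lia.
Qed.

Lemma clim_le (u : nat -> C) (l : C) (m : R) :
  clim u l -> (forall n, Cmod (u n) <= m) -> Cmod l <= m.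
Proof.
  intros H Hm. apply Rnot_lt_le. intros Hl.
  destruct (H (Cmod l - m)) as [N HN]; [lra|].
  specialize (HN N (le_n N)). specialize (Hm N).
  assert (Cmod l <= Cmod (u N) + Cmod (u N - l)%C).
  { rewrite <- (Cmod_opp (u N - l)%C). eapply Rle_trans; [|apply Cmod_triangle].
    apply Req_le. f_equal. ring. }
  lra.
Qed.

(** Dominated convergence for series (Tannery's theorem).  It carries both the
    product and the composition of power series: their partial sums are sums
    over [i < N] whose [i]-th term converges and is dominated. *)
Lemma clim_csum_dominated (u : nat -> nat -> C) (l : nat -> C) (x : nat -> R)
    (m : R) (L : C) :
  (forall N i, (i < N)%nat -> Cmod (u N i) <= x i) ->
  (forall N, rsum x N <= m) ->
  (forall i, clim (fun N => u N i) (l i)) ->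
  clim (csum l) L ->
  clim (fun N => csum (u N) N) L.
Proof.
  intros Hd Hm Hl HL.
  assert (Hx : forall i, 0 <= x i).
  { intros i. eapply Rle_trans; [apply Cmod_ge_0|apply (Hd (S i) i); lia]. }
  assert (Hlx : forall i, Cmod (l i) <= x i).
  { intros i. apply Rnot_lt_le. intros H.
    destruct (Hl i (Cmod (l i) - x i)) as [N HN]; [lra|].
    specialize (HN (N + S i)%nat ltac:(lia)).
    specialize (Hd (N + S i)%nat i ltac:(lia)).
    assert (Cmod (l i) <= Cmod (u (N + S i)%nat i) + Cmod (u (N + S i)%nat i - l i)%C).
    { rewrite <- (Cmod_opp (_ - l i)%C). eapply Rle_trans; [|apply Cmod_triangle].
      apply Req_le. f_equal. ring. }
    lra. }
  intros eps He.
  (* K is chosen so that the tail of x beyond K is small *)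
  assert (HK : exists K, forall N, (K <= N)%nat -> rsum x N - rsum x K < eps / 8).
  { apply Classical_Prop.NNPP. intros H.
    assert (H' : forall K, exists N, (K <= N)%nat /\ eps / 8 <= rsum x N - rsum x K).
    { intros K. apply Classical_Prop.NNPP. intros H1. apply H. exists K.
      intros N HN. apply Rnot_le_lt. intros H2. apply H1. exists N. auto. }
    assert (H2 : forall n, exists K, INR n * (eps / 8) <= rsum x K).
    { induction n as [|n [K IH]].
      - exists O. simpl. lra.
      - destruct (H' K) as [N [_ HN]]. exists N. rewrite S_INR. lra. }
    destruct (INR_unbounded (m / (eps / 8))) as [n Hn].
    destruct (H2 n) as [K HK]. specialize (Hm K).
    apply (Rmult_lt_compat_r (eps / 8)) in Hn; [|lra].
    replace (m / (eps / 8) * (eps / 8)) with m in Hn by (field; lra). lra. }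
  destruct HK as [K HK].
  assert (HF : exists N0, forall N, (N0 <= N)%nat ->
     rsum (fun i => Cmod (u N i - l i)%C) K < eps / 4).
  { clear HK. assert (Hgen : forall e, 0 < e -> exists N0, forall N, (N0 <= N)%nat ->
     rsum (fun i => Cmod (u N i - l i)%C) K < e).
    { induction K as [|K IH]; intros e Hpos.
      - exists O. intros; simpl; lra.
      - destruct (IH (e / 2)) as [N1 H1]; [lra|].
        destruct (Hl K (e / 2)) as [N2 H2]; [lra|].
        exists (N1 + N2)%nat. intros N HN. simpl.
        specialize (H1 N ltac:(lia)). specialize (H2 N ltac:(lia)). lra. }
    apply Hgen. lra. }
  destruct HF as [N0 HF].
  destruct (HL (eps / 4)) as [N1 HN1]; [lra|].
  exists (N0 + N1 + K)%nat. intros N HN.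
  replace (csum (u N) N - L)%C with
    (csum (fun i => u N i - l i)%C N + (csum l N - L))%C.
  2:{ rewrite (csum_ext _ (fun i => u N i + (-(1)) * l i)%C) by (intros; ring).
      rewrite csum_plus, csum_scal. ring. }
  eapply Rle_lt_trans; [apply Cmod_triangle|].
  specialize (HN1 N ltac:(lia)). specialize (HF N ltac:(lia)).
  specialize (HK N ltac:(lia)).
  assert (Hs : rsum (fun i => Cmod (u N i - l i)%C) N <=
     rsum (fun i => Cmod (u N i - l i)%C) K + 2 * (rsum x N - rsum x K)).
  { assert (Hgen : forall M, (K <= M)%nat -> (M <= N)%nat ->
      rsum (fun i => Cmod (u N i - l i)%C) M <=
      rsum (fun i => Cmod (u N i - l i)%C) K + 2 * (rsum x M - rsum x K)).
    { intros M HM. induction HM as [|M HM IH]; intros HMN; [lra|]. simpl.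
      specialize (IH ltac:(lia)). specialize (Hd N M ltac:(lia)).
      assert (Cmod (u N M - l M)%C <= Cmod (u N M) + Cmod (l M)).
      { rewrite <- (Cmod_opp (l M)). apply Cmod_triangle. }
      specialize (Hlx M). lra. }
    apply Hgen; lia. }
  assert (Hc := Cmod_csum (fun i => u N i - l i)%C N).
  lra.
Qed.

(** * Power series and their majorants *)

Definition term (a : nat -> C) (z : C) (n : nat) : C := (a n * z ^ n)%C.

(** Convergence of the majorant sum and a bound for its value, in one condition
    on finite sums; it is stable under the operations on series below. *)
Definition maj (a : nat -> C) (r m : R) : Prop :=
  forall N, rsum (fun n => Cmod (a n) * r ^ n) N <= m.

Lemma is_Cpseries_clim (a : nat -> C) (z s : C) :
  is_Cpseries a z s <-> clim (csum (term a z)) s.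
Proof.
  assert (E : forall n, csum (term a z) (S n) =
     @sum_n C_AbelianMonoid (fun k => @scal C_AbsRing C_NormedModule (@pow_n C_AbsRing z k) (a k)) n).
  { intros n. rewrite csum_sum_n. apply sum_n_ext. intros k. unfold term.
    assert (Hp : @pow_n C_AbsRing z k = (z ^ k)%C).
    { induction k as [|k IH]; simpl; [reflexivity|]. rewrite IH. reflexivity. }
    rewrite Hp. change (a k * z ^ k = z ^ k * a k)%C. ring. }
  unfold is_Cpseries, is_pseries, is_series.
  split; intros H.
  - intros eps He.
    assert (Hl := proj1 (@filterlim_locally nat C_UniformSpace eventually _ _ s) H).
    assert (He2 : 0 < eps / 2) by lra.
    destruct (Hl (mkposreal _ He2)) as [N HN].
    exists (S N). intros n Hn. destruct n as [|n]; [lia|].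
    specialize (HN n ltac:(lia)). rewrite E.
    assert (H1 := C_NormedModule_mixin_compat2 _ _ _ HN).
    eapply Rlt_trans; [exact H1|]. simpl.
    assert (sqrt 2 < 2).
    { rewrite <- (sqrt_square 2) at 2 by lra. apply sqrt_lt_1; lra. }
    nra.
  - apply (proj2 (@filterlim_locally nat C_UniformSpace eventually _ _ s)).
    intros eps. destruct (H eps (cond_pos eps)) as [N HN].
    exists N. intros n Hn. specialize (HN (S n) ltac:(lia)). rewrite E in HN.
    apply C_NormedModule_mixin_compat1. exact HN.
Qed.

Lemma maj_pos (a : nat -> C) (r m : R) : maj a r m -> 0 <= m.
Proof. intros H. exact (H O). Qed.

Lemma maj_weaken (a : nat -> C) (r m r' m' : R) :
  maj a r m -> 0 <= r' <= r -> m <= m' -> maj a r' m'.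
Proof.
  intros H Hr Hm N. eapply Rle_trans; [|exact Hm]. eapply Rle_trans; [|apply (H N)].
  apply rsum_le. intros n _. apply Rmult_le_compat_l; [apply Cmod_ge_0|].
  apply pow_incr. exact Hr.
Qed.

Lemma maj_converges (a : nat -> C) (r m : R) :
  0 <= r -> maj a r m -> converges_abs a r /\ abs_sum a r <= m.
Proof.
  intros Hr H.
  assert (Hp : forall n, 0 <= Cmod (a n) * r ^ n).
  { intros n. apply Rmult_le_pos; [apply Cmod_ge_0|apply pow_le; exact Hr]. }
  assert (E : ex_finite_lim_seq (sum_n (fun n => Cmod (a n) * r ^ n))).
  { apply (ex_finite_lim_seq_incr _ m).
    - intros n. rewrite sum_Sn. specialize (Hp (S n)). unfold plus; simpl in *. lra.
    - intros n. rewrite <- rsum_sum_n. apply H. }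
  assert (Hc : ex_series (fun n => Cmod (a n) * r ^ n)).
  { destruct E as [l Hl]. exists l. exact Hl. }
  split.
  - apply ex_pseries_R. exact Hc.
  - unfold abs_sum, PSeries.
    assert (Hl : is_lim_seq (sum_n (fun n => Cmod (a n) * r ^ n))
               (Series (fun n => Cmod (a n) * r ^ n))).
    { apply (Series_correct _ Hc). }
    assert (Hle := is_lim_seq_le _ (fun _ => m) _ m
      (fun n => eq_ind _ (fun y => y <= m) (H (S n)) _ (rsum_sum_n _ n)) Hl (is_lim_seq_const m)).
    exact Hle.
Qed.

Lemma converges_maj (a : nat -> C) (r : R) :
  0 <= r -> converges_abs a r -> maj a r (abs_sum a r).
Proof.
  intros Hr Hc.
  assert (Hp : forall n, 0 <= Cmod (a n) * r ^ n).
  { intros n. apply Rmult_le_pos; [apply Cmod_ge_0|apply pow_le; exact Hr]. }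
  apply ex_pseries_R in Hc.
  assert (HS : forall N, rsum (fun n => Cmod (a n) * r ^ n) (S N) <= abs_sum a r).
  { intros N. rewrite rsum_sum_n. unfold abs_sum, PSeries.
    apply (is_lim_seq_incr_compare (sum_n (fun n => Cmod (a n) * r ^ n))).
    - apply (Series_correct _ Hc).
    - intros n. rewrite sum_Sn. specialize (Hp (S n)). unfold plus; simpl in *. lra. }
  intros N. eapply Rle_trans; [|apply (HS N)]. simpl. specialize (Hp N). lra.
Qed.

Lemma Cmod_term_le (a : nat -> C) (z : C) (r : R) (n : nat) :
  Cmod z <= r -> Cmod (term a z n) <= Cmod (a n) * r ^ n.
Proof.
  intros Hz. unfold term. rewrite Cmod_mult, Cmod_pow.
  apply Rmult_le_compat_l; [apply Cmod_ge_0|].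
  apply pow_incr. split; [apply Cmod_ge_0|exact Hz].
Qed.

(** The sum of the series where it converges absolutely; a total function, so
    that identities between sums can be differentiated. *)
Definition ev (a : nat -> C) (z : C) : C :=
  (Series (fun n => Re (term a z n)), Series (fun n => Im (term a z n))).

Lemma csum_Re (u : nat -> C) (N : nat) :
  Re (csum u N) = rsum (fun n => Re (u n)) N.
Proof. induction N as [|N IH]; simpl; auto. rewrite <- IH. reflexivity. Qed.

Lemma csum_Im (u : nat -> C) (N : nat) :
  Im (csum u N) = rsum (fun n => Im (u n)) N.
Proof. induction N as [|N IH]; simpl; auto. rewrite <- IH. reflexivity. Qed.

Lemma im_le_Cmod (c : C) : Rabs (Im c) <= Cmod c.
Proof. eapply Rle_trans; [|apply Rmax_Cmod]. apply Rmax_r. Qed.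

Lemma Cmod_le_Re_Im (c : C) : Cmod c <= Rabs (Re c) + Rabs (Im c).
Proof.
  replace c with ((RtoC (Re c)) + Ci * RtoC (Im c))%C at 1.
  - eapply Rle_trans; [apply Cmod_triangle|].
    rewrite Cmod_mult, Cmod_Ci, !Cmod_R. lra.
  - destruct c as [x y]. unfold Ci, RtoC, Cplus, Cmult; simpl. f_equal; ring.
Qed.

Lemma ev_clim (a : nat -> C) (r m : R) (z : C) :
  maj a r m -> Cmod z <= r -> clim (csum (term a z)) (ev a z).
Proof.
  intros H Hz.
  assert (Hr : 0 <= r) by (eapply Rle_trans; [apply Cmod_ge_0|exact Hz]).
  destruct (maj_converges a r m Hr H) as [Hc _]. apply ex_pseries_R in Hc.
  assert (HR : ex_series (fun n => Re (term a z n))).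
  { apply (@ex_series_le R_AbsRing R_CompleteNormedModule _ (fun n => Cmod (a n) * r ^ n)); auto.
    intros n. eapply Rle_trans; [apply re_le_Cmod|]. apply Cmod_term_le. exact Hz. }
  assert (HI : ex_series (fun n => Im (term a z n))).
  { apply (@ex_series_le R_AbsRing R_CompleteNormedModule _ (fun n => Cmod (a n) * r ^ n)); auto.
    intros n. eapply Rle_trans; [apply im_le_Cmod|]. apply Cmod_term_le. exact Hz. }
  apply Series_correct in HR. apply Series_correct in HI.
  assert (HR' : is_lim_seq (sum_n (fun n => Re (term a z n)))
                 (Series (fun n => Re (term a z n)))) by exact HR.
  assert (HI' : is_lim_seq (sum_n (fun n => Im (term a z n)))
                 (Series (fun n => Im (term a z n)))) by exact HI.
  clear HR HI. apply is_lim_seq_spec in HR'. apply is_lim_seq_spec in HI'.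
  intros eps He. assert (He2 : 0 < eps / 2) by lra.
  destruct (HR' (mkposreal _ He2)) as [N1 H1]. destruct (HI' (mkposreal _ He2)) as [N2 H2].
  exists (S (N1 + N2)). intros n Hn. destruct n as [|n]; [lia|].
  specialize (H1 n ltac:(lia)). specialize (H2 n ltac:(lia)).
  eapply Rle_lt_trans; [apply Cmod_le_Re_Im|].
  assert (E1 : Re (csum (term a z) (S n) - ev a z)%C =
    sum_n (fun n => Re (term a z n)) n - Series (fun n => Re (term a z n))).
  { rewrite <- rsum_sum_n, <- csum_Re. reflexivity. }
  assert (E2 : Im (csum (term a z) (S n) - ev a z)%C =
    sum_n (fun n => Im (term a z n)) n - Series (fun n => Im (term a z n))).
  { rewrite <- rsum_sum_n, <- csum_Im. reflexivity. }
  rewrite E1, E2.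
  eapply Rlt_le_trans; [apply Rplus_lt_compat; [exact H1|exact H2]|simpl; lra].
Qed.

Lemma ev_unique (a : nat -> C) (r m : R) (z s : C) :
  maj a r m -> Cmod z <= r -> is_Cpseries a z s -> s = ev a z.
Proof.
  intros H Hz Hs. apply is_Cpseries_clim in Hs.
  eapply clim_unique; [exact Hs|]. eapply ev_clim; eauto.
Qed.

Lemma maj_partial (a : nat -> C) (r m : R) (z : C) (N : nat) :
  maj a r m -> Cmod z <= r -> Cmod (csum (term a z) N) <= m.
Proof.
  intros H Hz. eapply Rle_trans; [apply Cmod_csum|]. eapply Rle_trans; [|apply (H N)].
  apply rsum_le. intros n _. apply Cmod_term_le. exact Hz.
Qed.

Lemma ev_maj (a : nat -> C) (r m : R) (z : C) :
  maj a r m -> Cmod z <= r -> Cmod (ev a z) <= m.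
Proof.
  intros H Hz. eapply clim_le; [eapply ev_clim; eauto|].
  intros N. eapply maj_partial; eauto.
Qed.

Lemma rsum_geom (q : R) (N : nat) : 0 <= q < 1 -> rsum (pow q) N <= / (1 - q).
Proof.
  intros Hq. assert (E : rsum (pow q) N * (1 - q) = 1 - q ^ N).
  { induction N as [|N IH]; simpl; [ring|].
    rewrite Rmult_plus_distr_r, IH. ring. }
  assert (0 <= q ^ N) by (apply pow_le; lra).
  apply (Rmult_le_reg_r (1 - q)); [lra|]. rewrite E, Rinv_l by lra. lra.
Qed.

Lemma rsum_le_geom (u : nat -> R) (c q : R) (N : nat) :
  0 <= c -> 0 <= q < 1 -> (forall n, u n <= c * q ^ n) -> rsum u N <= c / (1 - q).
Proof.
  intros Hc Hq H. apply Rle_trans with (rsum (fun n => c * q ^ n) N).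
  - apply rsum_le. intros; apply H.
  - rewrite rsum_scal. unfold Rdiv. apply Rmult_le_compat_l; [exact Hc|].
    apply (rsum_geom q N Hq).
Qed.

(** Comparison with the geometric series of ratio [r / s]. *)
Lemma maj_of_bounded (a : nat -> C) (r s m : R) :
  0 <= r < s -> (forall n, Cmod (a n) * s ^ n <= m) -> maj a r (m / (1 - r / s)).
Proof.
  intros Hr H N.
  assert (Hm : 0 <= m).
  { eapply Rle_trans; [|apply (H 0%nat)]. simpl. assert (X := Cmod_ge_0 (a 0%nat)). lra. }
  apply rsum_le_geom; auto.
  - split; [apply Rmult_le_pos; [lra|apply Rlt_le, Rinv_0_lt_compat; lra]|].
    apply (Rmult_lt_reg_r s); [lra|]. field_simplify; lra.
  - intros n. replace (Cmod (a n) * r ^ n) with (Cmod (a n) * s ^ n * (r / s) ^ n).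
    + apply Rmult_le_compat_r; [|apply H]. apply pow_le.
      apply Rmult_le_pos; [lra|apply Rlt_le, Rinv_0_lt_compat; lra].
    + rewrite Rmult_assoc, <- Rpow_mult_distr. do 2 f_equal. field. lra.
Qed.

Lemma maj_coef (a : nat -> C) (r m : R) (n : nat) :
  0 <= r -> maj a r m -> Cmod (a n) * r ^ n <= m.
Proof.
  intros Hr H. eapply Rle_trans; [|apply (H (S n))]. simpl.
  assert (0 <= rsum (fun n => Cmod (a n) * r ^ n) n); [|lra].
  apply rsum_pos. intros k. apply Rmult_le_pos; [apply Cmod_ge_0|apply pow_le; exact Hr].
Qed.

Lemma clim_bounded (u : nat -> C) (l : C) :
  clim u l -> exists M, forall n, Cmod (u n) <= M.
Proof.
  intros H. destruct (H 1) as [N HN]; [lra|].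
  assert (HK : forall K, exists M, forall n, (n < K)%nat -> Cmod (u n) <= M).
  { induction K as [|K [M IH]].
    - exists 0. intros; lia.
    - exists (Rmax M (Cmod (u K))). intros n Hn.
      destruct (Nat.eq_dec n K) as [->|E]; [apply Rmax_r|].
      eapply Rle_trans; [apply IH; lia|apply Rmax_l]. }
  destruct (HK N) as [M HM]. exists (Rmax M (Cmod l + 1)). intros n.
  destruct (Nat.lt_ge_cases n N) as [E|E].
  - eapply Rle_trans; [apply HM; exact E|apply Rmax_l].
  - eapply Rle_trans; [|apply Rmax_r]. specialize (HN n E).
    replace (u n) with (l + (u n - l))%C by ring.
    eapply Rle_trans; [apply Cmod_triangle|]. lra.
Qed.

(** Convergence at the point [(r + d) / 2] bounds the terms there, which gives
    absolute convergence at the smaller radius [r]. *)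
Lemma maj_of_expansion (a : nat -> C) (f : C -> C) (d r : R) :
  (forall z, Cmod z < d -> is_Cpseries a z (f z)) -> 0 <= r < d ->
  exists m, maj a r m.
Proof.
  intros H Hr. set (s := (r + d) / 2).
  assert (Hs : 0 <= s) by (unfold s; lra).
  assert (Hz : Cmod (RtoC s) < d) by (rewrite Cmod_R, Rabs_pos_eq; unfold s in *; lra).
  specialize (H _ Hz). apply is_Cpseries_clim in H.
  destruct (clim_bounded _ _ H) as [M HM].
  exists (2 * M / (1 - r / s)). apply maj_of_bounded; [unfold s; lra|].
  intros n. replace (Cmod (a n) * s ^ n) with (Cmod (term a (RtoC s) n)).
  - replace (term a (RtoC s) n) with
      (csum (term a (RtoC s)) (S n) + - csum (term a (RtoC s)) n)%C by (simpl; ring).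
    eapply Rle_trans; [apply Cmod_triangle|]. rewrite Cmod_opp.
    assert (X := HM n). assert (Y := HM (S n)). lra.
  - unfold term. rewrite Cmod_mult, Cmod_pow, Cmod_R, Rabs_pos_eq by exact Hs. reflexivity.
Qed.

Lemma maj_lin (c : C) (a b : nat -> C) (r m m' : R) :
  0 <= r -> maj a r m -> maj b r m' ->
  maj (fun n => a n + c * b n)%C r (m + Cmod c * m').
Proof.
  intros Hr Ha Hb N.
  apply Rle_trans with (rsum (fun n => Cmod (a n) * r ^ n) N +
     Cmod c * rsum (fun n => Cmod (b n) * r ^ n) N).
  - clear Ha Hb. induction N as [|N IH]; simpl; [lra|].
    assert (0 <= r ^ N) by (apply pow_le; exact Hr).
    assert (Cmod (a N + c * b N)%C <= Cmod (a N) + Cmod c * Cmod (b N)).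
    { eapply Rle_trans; [apply Cmod_triangle|]. rewrite Cmod_mult. lra. }
    nra.
  - specialize (Ha N). specialize (Hb N). assert (X := Cmod_ge_0 c). nra.
Qed.

Lemma ev_lin (c : C) (a b : nat -> C) (r m m' : R) (z : C) :
  maj a r m -> maj b r m' -> Cmod z <= r ->
  ev (fun n => a n + c * b n)%C z = (ev a z + c * ev b z)%C.
Proof.
  intros Ha Hb Hz.
  assert (Hr : 0 <= r) by (eapply Rle_trans; [apply Cmod_ge_0|exact Hz]).
  symmetry. apply (ev_unique _ r (m + Cmod c * m')); auto using maj_lin.
  apply is_Cpseries_clim.
  eapply clim_ext with (u := fun N => (csum (term a z) N + c * csum (term b z) N)%C).
  - intros N. rewrite <- csum_scal, <- csum_plus. apply csum_ext. intros n _.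
    unfold term. ring.
  - apply clim_plus; [|apply clim_scal]; eapply ev_clim; eauto.
Qed.

Definition shift (a : nat -> C) (n : nat) : C := a (S n).

Lemma maj_shift (a : nat -> C) (r m : R) : 0 < r -> maj a r m -> maj (shift a) r ((m - Cmod (a 0%nat)) / r).
Proof.
  intros Hr H N. specialize (H (S N)). rewrite rsum_shift in H. simpl in H.
  apply (Rmult_le_reg_l r); [exact Hr|]. rewrite <- rsum_scal.
  rewrite (rsum_ext _ (fun n => Cmod (a (S n)) * (r * r ^ n))) by (intros; unfold shift; ring).
  replace (r * ((m - Cmod (a 0%nat)) / r)) with (m - Cmod (a 0%nat)) by (field; lra).
  lra.
Qed.

Lemma ev_shift (a : nat -> C) (r m : R) (z : C) :
  0 < r -> maj a r m -> Cmod z <= r -> ev a z = (a 0%nat + z * ev (shift a) z)%C.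
Proof.
  intros Hr H Hz. symmetry. apply (ev_unique a r m); auto.
  apply is_Cpseries_clim. apply (clim_shift _ 0).
  assert (X := ev_clim _ _ _ _ (maj_shift _ _ _ Hr H) Hz).
  apply (clim_scal z) in X. assert (Y := clim_plus _ _ _ _ (clim_const (a 0%nat)) X).
  apply (clim_shift _ 1) in Y. intros eps He. destruct (Y eps He) as [N HN].
  exists (S N). intros n Hn. specialize (HN n ltac:(lia)).
  destruct n as [|n]; [lia|]. simpl in HN. rewrite Nat.sub_0_r in *.
  rewrite csum_shift. unfold term at 1.
  rewrite (csum_ext (fun n => term a z (S n)) (fun n => z * term (shift a) z n)%C).
  - rewrite csum_scal. simpl. replace (a 0%nat * 1)%C with (a 0%nat) by ring. exact HN.
  - intros k _. unfold term, shift. simpl. ring.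
Qed.

Lemma ev_0 (a : nat -> C) : ev a 0 = a 0%nat.
Proof.
  assert (H : maj a 0 (Cmod (a 0%nat))).
  { intros N. destruct N as [|N]; [simpl; apply Cmod_ge_0|]. rewrite rsum_shift.
    rewrite (rsum_ext _ (fun _ => 0 * 0)) by (intros; simpl; ring).
    rewrite rsum_scal. simpl. lra. }
  symmetry. apply (ev_unique a 0 _ 0 _ H); [rewrite Cmod_0; lra|].
  apply is_Cpseries_clim. intros eps He. exists 1%nat. intros n Hn.
  destruct n as [|n]; [lia|]. rewrite csum_shift.
  rewrite (csum_ext _ (fun _ => 0 * 0)%C) by (intros; unfold term; simpl; ring).
  rewrite csum_scal. unfold term. simpl.
  replace (a 0%nat * 1 + 0 * csum (fun _ => 0) n - a 0%nat)%C with (RtoC 0) by ring.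
  rewrite Cmod_0. exact He.
Qed.

(** The constant term is the limit at 0, hence zero; dividing by the variable
    then reduces every coefficient to the constant one. *)
Lemma ev_zero_near (a : nat -> C) (r m d : R) :
  0 < r -> 0 < d -> maj a r m ->
  (forall z, 0 < Cmod z < d -> ev a z = 0) -> forall n, a n = 0.
Proof.
  intros Hr Hd H Hz n. revert a m d Hd H Hz.
  assert (H0 : forall a m d, 0 < d -> maj a r m -> (forall z, 0 < Cmod z < d -> ev a z = 0) -> a 0%nat = 0).
  { intros a m d Hd H Hz. destruct (Ceq_dec (a 0%nat) 0) as [E|E]; auto. exfalso.
    apply Cmod_gt_0 in E. assert (Hs := maj_shift _ _ _ Hr H).
    set (m' := (m - Cmod (a 0%nat)) / r) in *. assert (Hm' := maj_pos _ _ _ Hs).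
    set (t := Rmin (Rmin (r / 2) (d / 2)) (Cmod (a 0%nat) / (2 * (m' + 1)))).
    assert (Ht : 0 < t).
    { unfold t. repeat apply Rmin_glb_lt; try lra. apply Rdiv_lt_0_compat; lra. }
    assert (Ht1 : t <= r / 2) by (unfold t; eapply Rle_trans; [apply Rmin_l|apply Rmin_l]).
    assert (Ht2 : t <= d / 2) by (unfold t; eapply Rle_trans; [apply Rmin_l|apply Rmin_r]).
    assert (Ht3 : t <= Cmod (a 0%nat) / (2 * (m' + 1))) by apply Rmin_r.
    assert (Hc : Cmod (RtoC t) = t) by (rewrite Cmod_R; apply Rabs_pos_eq; lra).
    specialize (Hz (RtoC t) ltac:(rewrite Hc; lra)).
    rewrite (ev_shift a r m) in Hz by (auto; rewrite Hc; lra).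
    assert (Hb := ev_maj _ _ _ (RtoC t) Hs ltac:(rewrite Hc; lra)).
    assert (E1 : a 0%nat = (- (RtoC t * ev (shift a) (RtoC t)))%C).
    { transitivity ((a 0%nat + RtoC t * ev (shift a) (RtoC t)) - (RtoC t * ev (shift a) (RtoC t)))%C;
      [ring|]. rewrite Hz. ring. }
    assert (E2 : Cmod (a 0%nat) <= t * m').
    { rewrite E1, Cmod_opp, Cmod_mult, Hc. apply Rmult_le_compat_l; lra. }
    apply (Rmult_le_compat_r (2 * (m' + 1))) in Ht3; [|lra].
    replace (Cmod (a 0%nat) / (2 * (m' + 1)) * (2 * (m' + 1))) with (Cmod (a 0%nat)) in Ht3
      by (field; lra).
    nra. }
  induction n as [|n IH]; intros a m d Hd H Hz.
  - eapply H0; eauto.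
  - assert (Hs := maj_shift _ _ _ Hr H).
    (* the identity for the shifted series also needs the original one to converge *)
    assert (Hz' : forall z, 0 < Cmod z < Rmin d r -> ev (shift a) z = 0).
    { intros z [Hz1 Hz2].
      assert (Hzd : Cmod z < d) by (eapply Rlt_le_trans; [exact Hz2|apply Rmin_l]).
      assert (Hzr : Cmod z < r) by (eapply Rlt_le_trans; [exact Hz2|apply Rmin_r]).
      assert (E := ev_shift a r m z Hr H ltac:(lra)).
      rewrite Hz in E by lra. rewrite (H0 a m d Hd H Hz) in E.
      assert (Hnz : z <> 0) by (apply Cmod_gt_0; exact Hz1).
      replace (ev (shift a) z) with (/ z * (0 + z * ev (shift a) z))%C by (field; exact Hnz).
      rewrite <- E. ring. }
    apply (IH (shift a) _ (Rmin d r)) with (2 := Hs); auto.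
    apply Rmin_glb_lt; assumption.
Qed.

Lemma ev_inj (a b : nat -> C) (r m m' d : R) :
  0 < r -> 0 < d -> maj a r m -> maj b r m' ->
  (forall z, 0 < Cmod z < d -> ev a z = ev b z) -> forall n, a n = b n.
Proof.
  intros Hr Hd Ha Hb H n.
  assert (E : (a n + (-(1)) * b n)%C = 0).
  { apply (ev_zero_near (fun n => a n + (-(1)) * b n)%C r (m + Cmod (-(1))%C * m') (Rmin d r)); auto.
    - apply Rmin_glb_lt; assumption.
    - apply maj_lin; auto. lra.
    - intros z [Hz1 Hz2].
      assert (Hzd : Cmod z < d) by (eapply Rlt_le_trans; [exact Hz2|apply Rmin_l]).
      assert (Hzr : Cmod z < r) by (eapply Rlt_le_trans; [exact Hz2|apply Rmin_r]).
      rewrite (ev_lin _ a b r m m') by (auto; lra). rewrite H by lra. ring. }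
  replace (a n) with (a n + (-(1)) * b n + b n)%C by ring. rewrite E. ring.
Qed.

(** * Products and compositions *)

Definition conv (a b : nat -> C) (n : nat) : C :=
  csum (fun i => a i * b (n - i)%nat)%C (S n).

Lemma rsum_triangle (x y : nat -> R) (N : nat) :
  rsum (fun n => rsum (fun i => x i * y (n - i)%nat) (S n)) N =
  rsum (fun i => x i * rsum y (N - i)) N.
Proof.
  induction N as [|N IH]; [reflexivity|].
  change (rsum (fun n => rsum (fun i => x i * y (n - i)%nat) (S n)) N +
     rsum (fun i => x i * y (N - i)%nat) (S N) = rsum (fun i => x i * rsum y (S N - i)) (S N)).
  rewrite IH.
  transitivity (rsum (fun i => x i * rsum y (N - i)) (S N) +
     rsum (fun i => x i * y (N - i)%nat) (S N)).
  - simpl. rewrite Nat.sub_diag. simpl. ring.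
  - assert (G : forall M, (M <= S N)%nat ->
      rsum (fun i => x i * rsum y (N - i)) M + rsum (fun i => x i * y (N - i)%nat) M =
      rsum (fun i => x i * rsum y (S N - i)) M).
    { induction M as [|M IHM]; intros HM; [simpl; ring|].
      rewrite !rsum_S, <- IHM by lia. replace (S N - M)%nat with (S (N - M)) by lia.
      rewrite rsum_S. ring. }
    apply G. lia.
Qed.

Lemma csum_triangle (x y : nat -> C) (N : nat) :
  csum (fun n => csum (fun i => x i * y (n - i)%nat)%C (S n)) N =
  csum (fun i => x i * csum y (N - i))%C N.
Proof.
  induction N as [|N IH]; [reflexivity|].
  change (csum (fun n => csum (fun i => x i * y (n - i)%nat)%C (S n)) N +
     csum (fun i => x i * y (N - i)%nat) (S N) = csum (fun i => x i * csum y (S N - i)) (S N))%C.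
  rewrite IH.
  transitivity (csum (fun i => x i * csum y (N - i)) (S N) +
     csum (fun i => x i * y (N - i)%nat) (S N))%C.
  - simpl. rewrite Nat.sub_diag. simpl. ring.
  - assert (G : forall M, (M <= S N)%nat ->
      (csum (fun i => x i * csum y (N - i)) M + csum (fun i => x i * y (N - i)%nat) M =
      csum (fun i => x i * csum y (S N - i)) M)%C).
    { induction M as [|M IHM]; intros HM; [simpl; ring|].
      rewrite !csum_S, <- IHM by lia. replace (S N - M)%nat with (S (N - M)) by lia.
      rewrite csum_S. ring. }
    apply G. lia.
Qed.

Lemma Cmod_conv_le (a b : nat -> C) (n : nat) :
  Cmod (conv a b n) <= rsum (fun i => Cmod (a i) * Cmod (b (n - i)%nat)) (S n).
Proof.
  eapply Rle_trans; [apply Cmod_csum|]. apply rsum_le. intros i _.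
  rewrite Cmod_mult. lra.
Qed.

Lemma rsum_conv_le (x y : nat -> R) (r m m' : R) (N : nat) :
  0 <= r -> (forall n, 0 <= x n) -> (forall n, 0 <= y n) ->
  (forall N, rsum (fun n => x n * r ^ n) N <= m) ->
  (forall N, rsum (fun n => y n * r ^ n) N <= m') ->
  rsum (fun n => rsum (fun i => x i * y (n - i)%nat) (S n) * r ^ n) N <= m * m'.
Proof.
  intros Hr Hx Hy Hm Hm'.
  rewrite (rsum_ext _ (fun n => rsum (fun i => (x i * r ^ i) *
     (fun j => y j * r ^ j) (n - i)%nat) (S n))).
  - rewrite (rsum_triangle (fun i => x i * r ^ i) (fun j => y j * r ^ j)).
    apply Rle_trans with (rsum (fun i => m' * (x i * r ^ i)) N).
    + apply rsum_le. intros i _. rewrite Rmult_comm. apply Rmult_le_compat_r.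
      * apply Rmult_le_pos; [apply Hx|apply pow_le; exact Hr].
      * apply Hm'.
    + rewrite rsum_scal, Rmult_comm. apply Rmult_le_compat_r; [apply (Hm' O)|apply Hm].
  - intros n _. rewrite Rmult_comm, <- rsum_scal. apply rsum_ext. intros i Hi.
    replace (r ^ n) with (r ^ i * r ^ (n - i)) by (rewrite <- pow_add; f_equal; lia). ring.
Qed.

Lemma maj_conv (a b : nat -> C) (r m m' : R) :
  0 <= r -> maj a r m -> maj b r m' -> maj (conv a b) r (m * m').
Proof.
  intros Hr Ha Hb N.
  eapply Rle_trans; [|apply (rsum_conv_le (fun i => Cmod (a i)) (fun i => Cmod (b i)) r m m' N)];
    auto using Cmod_ge_0.
  apply rsum_le. intros n _. apply Rmult_le_compat_r; [apply pow_le; exact Hr|].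
  apply Cmod_conv_le.
Qed.

Lemma ev_conv (a b : nat -> C) (r m m' : R) (z : C) :
  maj a r m -> maj b r m' -> Cmod z <= r -> ev (conv a b) z = (ev a z * ev b z)%C.
Proof.
  intros Ha Hb Hz.
  assert (Hr : 0 <= r) by (eapply Rle_trans; [apply Cmod_ge_0|exact Hz]).
  symmetry. apply (ev_unique _ r (m * m')); auto using maj_conv.
  apply is_Cpseries_clim.
  apply clim_ext with (u := fun N => csum (fun i => term a z i * csum (term b z) (N - i))%C N).
  - intros N. rewrite <- csum_triangle. apply csum_ext. intros n _.
    unfold term, conv. rewrite (Cmult_comm (csum _ _)), <- csum_scal.
    apply csum_ext. intros i Hi.
    replace (z ^ n)%C with (z ^ i * z ^ (n - i))%C by (rewrite <- Cpow_add_r; f_equal; lia). ring.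
  - assert (Hm' := maj_pos _ _ _ Hb).
    apply clim_csum_dominated with (l := fun i => (term a z i * ev b z)%C)
      (x := fun i => m' * (Cmod (a i) * r ^ i)) (m := m' * m).
    + intros N i Hi. rewrite Cmod_mult, Rmult_comm. apply Rmult_le_compat; try apply Cmod_ge_0.
      * eapply maj_partial; eauto.
      * apply Cmod_term_le; exact Hz.
    + intros N. rewrite rsum_scal. apply Rmult_le_compat_l; auto.
    + intros i. apply clim_scal. apply (clim_shift (csum (term b z)) i). eapply ev_clim; eauto.
    + apply clim_ext with (u := fun N => (ev b z * csum (term a z) N)%C).
      * intros N. rewrite <- csum_scal. apply csum_ext. intros; ring.
      * rewrite (Cmult_comm (ev a z)). apply clim_scal. eapply ev_clim; eauto.
Qed.

Definition one_series (n : nat) : C := match n with O => RtoC 1 | _ => RtoC 0 end.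

Fixpoint conv_pow (w : nat -> C) (k : nat) : nat -> C :=
  match k with O => one_series | S k => conv w (conv_pow w k) end.

(** Coefficients of [c o w] for [w 0 = 0]: the [k]-th power of [w] starts at
    index [k], so the powers up to [n] suffice for the coefficient [n]. *)
Definition substitute (c w : nat -> C) (n : nat) : C :=
  csum (fun k => c k * conv_pow w k n)%C (S n).

Lemma maj_one (r : R) : maj one_series r 1.
Proof.
  intros N. destruct N as [|N]; [simpl; lra|]. rewrite rsum_shift.
  rewrite (rsum_ext _ (fun _ => 0 * 0)) by (intros; simpl; rewrite Cmod_0; ring).
  rewrite rsum_scal. simpl. rewrite Cmod_1. lra.
Qed.

Lemma ev_one (z : C) : ev one_series z = RtoC 1.
Proof.
  assert (Hz : 0 < Cmod z + 1) by (assert (X := Cmod_ge_0 z); lra).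
  rewrite (ev_shift _ (Cmod z + 1) 1); [|exact Hz|apply maj_one|lra].
  assert (E : ev (shift one_series) z = 0).
  { symmetry. eapply (ev_unique _ (Cmod z + 1)); [apply maj_shift; [exact Hz|apply maj_one]|lra|].
    apply is_Cpseries_clim.
    apply clim_ext with (u := fun _ => RtoC 0); [|apply clim_const].
    intros n. rewrite (csum_ext _ (fun _ => 0 * 0)%C) by (intros; unfold term, shift; simpl; ring).
    rewrite csum_scal. ring. }
  rewrite E. simpl. ring.
Qed.

Lemma conv_pow_low (w : nat -> C) (k n : nat) :
  w 0%nat = 0 -> (n < k)%nat -> conv_pow w k n = 0.
Proof.
  intros H0. revert n. induction k as [|k IH]; intros n Hn; [lia|].
  simpl. unfold conv. rewrite (csum_ext _ (fun _ => 0 * 0)%C).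
  - rewrite csum_scal. ring.
  - intros i Hi. destruct i as [|i].
    + rewrite H0. ring.
    + rewrite (IH (n - S i)%nat) by lia. ring.
Qed.

Lemma maj_conv_pow (w : nat -> C) (r u : R) (k : nat) :
  0 <= r -> maj w r u -> maj (conv_pow w k) r (u ^ k).
Proof. intros Hr Hw. induction k; [apply maj_one|]. simpl. apply maj_conv; auto. Qed.

Lemma ev_conv_pow (w : nat -> C) (r u : R) (k : nat) (z : C) :
  maj w r u -> Cmod z <= r -> ev (conv_pow w k) z = (ev w z ^ k)%C.
Proof.
  intros Hw Hz.
  assert (Hr : 0 <= r) by (eapply Rle_trans; [apply Cmod_ge_0|exact Hz]).
  induction k as [|k IH]; [apply ev_one|]. simpl.
  rewrite (ev_conv _ _ r u (u ^ k)); auto using maj_conv_pow. rewrite IH. reflexivity.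
Qed.

Lemma substitute_extend (c w : nat -> C) (n N : nat) :
  w 0%nat = 0 -> (n < N)%nat ->
  substitute c w n = csum (fun k => c k * conv_pow w k n)%C N.
Proof.
  intros H0 HN. unfold substitute. induction HN as [|N HN IH]; [reflexivity|].
  simpl. rewrite <- IH, (conv_pow_low w N n) by auto. simpl. ring.
Qed.

Lemma rsum_switch (u : nat -> nat -> R) (N M : nat) :
  rsum (fun i => rsum (u i) M) N = rsum (fun j => rsum (fun i => u i j) N) M.
Proof.
  induction N as [|N IH]; simpl.
  - induction M; simpl; [reflexivity|]. rewrite <- IHM. ring.
  - rewrite IH. clear IH. induction M as [|M IH]; simpl; [ring|]. rewrite <- IH. ring.
Qed.

(** Majorants are submultiplicative.  With [w^(r) <= r] this becomes Bohr's
    principle for subordinate functions. *)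
Lemma maj_substitute (c w : nat -> C) (r u m : R) :
  0 <= r -> w 0%nat = 0 -> maj w r u -> maj c u m -> maj (substitute c w) r m.
Proof.
  intros Hr H0 Hw Hc N. eapply Rle_trans; [|apply (Hc N)].
  apply Rle_trans with (rsum (fun n => rsum (fun k =>
     Cmod (c k) * (Cmod (conv_pow w k n) * r ^ n)) N) N).
  - apply rsum_le. intros n Hn. rewrite (substitute_extend c w n N) by auto.
    rewrite Rmult_comm.
    eapply Rle_trans; [apply Rmult_le_compat_l; [apply pow_le; exact Hr|apply Cmod_csum]|].
    rewrite <- rsum_scal. apply rsum_le. intros k _. rewrite Cmod_mult. apply Req_le. ring.
  - rewrite rsum_switch. apply rsum_le. intros k _. rewrite rsum_scal.
    apply Rmult_le_compat_l; [apply Cmod_ge_0|]. apply maj_conv_pow; auto.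
Qed.

Lemma ev_substitute (c w : nat -> C) (r u m : R) (z : C) :
  w 0%nat = 0 -> maj w r u -> maj c u m -> Cmod z <= r ->
  ev (substitute c w) z = ev c (ev w z).
Proof.
  intros H0 Hw Hc Hz.
  assert (Hr : 0 <= r) by (eapply Rle_trans; [apply Cmod_ge_0|exact Hz]).
  assert (Hu := maj_pos _ _ _ Hw).
  assert (Hwz := ev_maj _ _ _ _ Hw Hz).
  symmetry. apply (ev_unique _ r m); auto; [eapply maj_substitute; eauto|].
  apply is_Cpseries_clim.
  apply clim_ext with (u := fun N => csum (fun k => c k * csum (term (conv_pow w k) z) N)%C N).
  - intros N.
    rewrite (csum_ext (fun k => c k * csum (term (conv_pow w k) z) N)%C
      (fun k => csum (fun n => c k * term (conv_pow w k) z n)%C N)) by (intros; rewrite csum_scal; reflexivity).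
    rewrite csum_switch. apply csum_ext. intros n Hn. unfold term at 2.
    rewrite (substitute_extend c w n N) by auto. rewrite Cmult_comm, <- csum_scal.
    apply csum_ext. intros k _. unfold term. ring.
  - apply clim_csum_dominated with (l := fun k => term c (ev w z) k)
      (x := fun k => Cmod (c k) * u ^ k) (m := m).
    + intros N k _. rewrite Cmod_mult. apply Rmult_le_compat_l; [apply Cmod_ge_0|].
      apply (maj_partial _ r (u ^ k)); [apply maj_conv_pow; auto|exact Hz].
    + exact Hc.
    + intros k. unfold term. apply clim_scal. rewrite <- (ev_conv_pow w r u) by auto.
      apply (ev_clim _ r (u ^ k)); [apply maj_conv_pow; auto|exact Hz].
    + eapply ev_clim; eauto.
Qed.

(** * Complex derivatives *)

Definition is_Cderive (f : C -> C) (z l : C) : Prop :=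
  @is_derive C_AbsRing C_NormedModule f z l.

(** The module of values in [is_Cderive] and the ring seen as a module over
    itself carry different uniform structures; this description of the
    derivative is common to both, and transports the product and chain rules. *)
Definition diff_quot_small (f : C -> C) (z l : C) : Prop :=
  forall eps, 0 < eps -> exists d, 0 < d /\ forall y, Cmod (y - z)%C < d ->
    Cmod (f y - f z - (y - z) * l)%C <= eps * Cmod (y - z)%C.

Lemma is_Cderive_eps (f : C -> C) (z l : C) :
  is_Cderive f z l <-> diff_quot_small f z l.
Proof.
  split.
  - intros [_ H] eps He. specialize (H z (fun P HP => HP) (mkposreal _ He)).
    destruct H as [d Hd]. exists d. split; [apply cond_pos|].
    intros y Hy. exact (Hd y Hy).
  - intros H. split; [apply @is_linear_scal_l|].
    intros x Hx eps. apply (@is_filter_lim_locally_unique C_AbsRing (AbsRing_NormedModule C_AbsRing)) in Hx.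
    subst x. destruct (H eps (cond_pos eps)) as [d [Hd Hy]].
    exists (mkposreal _ Hd). intros y Hb. exact (Hy y Hb).
Qed.

Lemma is_Kderive_eps (f : C -> C) (z l : C) :
  @is_derive C_AbsRing (AbsRing_NormedModule C_AbsRing) f z l <-> diff_quot_small f z l.
Proof.
  split.
  - intros [_ H] eps He. specialize (H z (fun P HP => HP) (mkposreal _ He)).
    destruct H as [d Hd]. exists d. split; [apply cond_pos|].
    intros y Hy. exact (Hd y Hy).
  - intros H. split; [apply @is_linear_scal_l|].
    intros x Hx eps. apply (@is_filter_lim_locally_unique C_AbsRing (AbsRing_NormedModule C_AbsRing)) in Hx.
    subst x. destruct (H eps (cond_pos eps)) as [d [Hd Hy]].
    exists (mkposreal _ Hd). intros y Hb. exact (Hy y Hb).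
Qed.

Lemma is_Cderive_K (f : C -> C) (z l : C) :
  is_Cderive f z l <-> @is_derive C_AbsRing (AbsRing_NormedModule C_AbsRing) f z l.
Proof. rewrite is_Cderive_eps, is_Kderive_eps. reflexivity. Qed.

Lemma is_Cderive_mult (f g : C -> C) (z df dg : C) :
  is_Cderive f z df -> is_Cderive g z dg ->
  is_Cderive (fun y => f y * g y)%C z (df * g z + f z * dg)%C.
Proof.
  rewrite !is_Cderive_K. intros Hf Hg.
  apply (@is_derive_mult C_AbsRing f g z df dg Hf Hg). exact Cmult_comm.
Qed.

Lemma is_Cderive_comp (f g : C -> C) (z df dg : C) :
  is_Cderive f (g z) df -> is_Cderive g z dg ->
  is_Cderive (fun y => f (g y)) z (dg * df)%C.
Proof.
  rewrite !is_Cderive_K. intros Hf Hg.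
  apply (@is_derive_comp C_AbsRing (AbsRing_NormedModule C_AbsRing) f g z df dg Hf Hg).
Qed.

Lemma is_Cderive_plus (f g : C -> C) (z df dg : C) :
  is_Cderive f z df -> is_Cderive g z dg ->
  is_Cderive (fun y => f y + g y)%C z (df + dg)%C.
Proof. intros Hf Hg. exact (is_derive_plus _ _ _ _ _ Hf Hg). Qed.

Lemma is_Cderive_id (z : C) : is_Cderive (fun y => y) z 1.
Proof. rewrite is_Cderive_K. apply @is_derive_id. Qed.

Lemma is_Cderive_const (c z : C) : is_Cderive (fun _ => c) z 0.
Proof. apply @is_derive_const. Qed.

Lemma is_Cderive_local (f g : C -> C) (z l : C) (d : R) :
  0 < d -> (forall y, Cmod (y - z)%C < d -> f y = g y) ->
  is_Cderive f z l -> is_Cderive g z l.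
Proof.
  intros Hd H. apply @is_derive_ext_loc. exists (mkposreal _ Hd).
  intros y Hy. apply H. exact Hy.
Qed.

Lemma is_Cderive_unique (f : C -> C) (z l l' : C) :
  is_Cderive f z l -> is_Cderive f z l' -> l = l'.
Proof.
  intros H H'. rewrite <- (is_C_derive_unique f z l H). apply (is_C_derive_unique f z l' H').
Qed.

Lemma is_Cderive_quadratic (f : C -> C) (z l : C) (d M : R) :
  0 < d -> (forall y, Cmod (y - z)%C < d ->
    Cmod (f y - f z - (y - z) * l)%C <= M * Cmod (y - z)%C ^ 2) ->
  is_Cderive f z l.
Proof.
  intros Hd H. apply is_Cderive_eps. intros eps He.
  exists (Rmin d (eps / (Rabs M + 1))).
  assert (HM := Rabs_pos M).
  split; [apply Rmin_glb_lt; [exact Hd|apply Rdiv_lt_0_compat; lra]|].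
  intros y Hy.
  assert (Hy1 : Cmod (y - z)%C < d) by (eapply Rlt_le_trans; [exact Hy|apply Rmin_l]).
  assert (Hy2 : Cmod (y - z)%C < eps / (Rabs M + 1)) by (eapply Rlt_le_trans; [exact Hy|apply Rmin_r]).
  eapply Rle_trans; [apply (H y Hy1)|].
  apply (Rmult_lt_compat_r (Rabs M + 1)) in Hy2; [|lra].
  replace (eps / (Rabs M + 1) * (Rabs M + 1)) with eps in Hy2 by (field; lra).
  assert (X := Cmod_ge_0 (y - z)%C). assert (Y := Rle_abs M).
  simpl. rewrite Rmult_1_r, <- Rmult_assoc. apply Rmult_le_compat_r; [exact X|]. nra.
Qed.

Lemma is_Cderive_continuous (f : C -> C) (z l : C) :
  is_Cderive f z l ->
  forall eps, 0 < eps -> exists d, 0 < d /\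
    forall y, Cmod (y - z)%C < d -> Cmod (f y - f z)%C < eps.
Proof.
  intros H eps He. apply is_Cderive_eps in H. destruct (H 1 Rlt_0_1) as [d [Hd Hy]].
  assert (Hl := Cmod_ge_0 l).
  exists (Rmin d (eps / (Cmod l + 2))). split.
  { apply Rmin_glb_lt; [exact Hd|apply Rdiv_lt_0_compat; lra]. }
  intros y Hyd.
  assert (Hy1 : Cmod (y - z)%C < d) by (eapply Rlt_le_trans; [exact Hyd|apply Rmin_l]).
  assert (Hy2 : Cmod (y - z)%C < eps / (Cmod l + 2)) by (eapply Rlt_le_trans; [exact Hyd|apply Rmin_r]).
  specialize (Hy y Hy1).
  replace (f y - f z)%C with ((f y - f z - (y - z) * l) + (y - z) * l)%C by ring.
  eapply Rle_lt_trans; [apply Cmod_triangle|]. rewrite Cmod_mult.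
  apply (Rmult_lt_compat_r (Cmod l + 2)) in Hy2; [|lra].
  replace (eps / (Cmod l + 2) * (Cmod l + 2)) with eps in Hy2 by (field; lra).
  assert (X := Cmod_ge_0 (y - z)%C). nra.
Qed.

(** * Termwise differentiation *)

Definition der (a : nat -> C) (n : nat) : C := (RtoC (INR (S n)) * a (S n))%C.

(** The Cauchy square of the geometric series. *)
Lemma rsum_arith_geom (q : R) (N : nat) :
  0 <= q < 1 -> rsum (fun n => INR (S n) * q ^ n) N <= / (1 - q) * / (1 - q).
Proof.
  intros Hq.
  assert (X := rsum_conv_le (fun _ => 1) (fun _ => 1) q (/ (1 - q)) (/ (1 - q)) N (proj1 Hq)
    (fun _ => Rle_0_1) (fun _ => Rle_0_1)).
  assert (Y : forall N, rsum (fun n => 1 * q ^ n) N <= / (1 - q)).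
  { intros M. rewrite (rsum_ext _ (pow q)) by (intros; ring). apply rsum_geom; exact Hq. }
  eapply Rle_trans; [|apply (X Y Y)]. apply rsum_le. intros n _. apply Rmult_le_compat_r.
  - apply pow_le; lra.
  - assert (E : forall M, rsum (fun _ => 1 * 1) M = INR M).
    { induction M as [|M IH]; [reflexivity|]. rewrite rsum_S, IH, S_INR. ring. }
    rewrite E. lra.
Qed.

Lemma maj_der (a : nat -> C) (r s m : R) :
  0 <= r < s -> maj a s m -> exists m', maj (der a) r m'.
Proof.
  intros Hr H.
  assert (Hq : 0 <= r / s < 1).
  { split; [apply Rmult_le_pos; [lra|apply Rlt_le, Rinv_0_lt_compat; lra]|].
    apply (Rmult_lt_reg_r s); [lra|]. field_simplify; lra. }
  exists (m / s * (/ (1 - r / s) * / (1 - r / s))). intros N.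
  eapply Rle_trans; [|apply Rmult_le_compat_l; [|apply (rsum_arith_geom (r / s) N Hq)]].
  - rewrite <- rsum_scal. apply rsum_le. intros n _. unfold der.
    rewrite Cmod_mult, Cmod_R, Rabs_pos_eq by apply pos_INR.
    assert (X := maj_coef a s m (S n) ltac:(lra) H).
    replace (INR (S n) * Cmod (a (S n)) * r ^ n) with
      (Cmod (a (S n)) * s ^ S n * (/ s * (INR (S n) * (r / s) ^ n))).
    + replace (m / s * (INR (S n) * (r / s) ^ n)) with (m * (/ s * (INR (S n) * (r / s) ^ n)))
        by (field; lra).
      apply Rmult_le_compat_r; [|exact X].
      apply Rmult_le_pos; [apply Rlt_le, Rinv_0_lt_compat; lra|].
      apply Rmult_le_pos; [apply pos_INR|apply pow_le; lra].
    + unfold Rdiv. rewrite Rpow_mult_distr, pow_inv by lra. simpl. field.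
      split; [apply pow_nonzero|]; lra.
  - apply Rmult_le_pos; [apply (maj_pos _ _ _ H)|apply Rlt_le, Rinv_0_lt_compat; lra].
Qed.

(** With [e_n = y^n - z^n - n (y - z) z^(n-1)] the bound follows from
    [e_(n+1) = y e_n + n (y - z)^2 z^(n-1)]. *)
Lemma pow_remainder (z y : C) (rho : R) (n : nat) :
  Cmod z <= rho -> Cmod y <= rho ->
  Cmod (y ^ S (S n) - z ^ S (S n) - (y - z) * (RtoC (INR (S (S n))) * z ^ S n))%C
  <= Cmod (y - z)%C ^ 2 * (INR (S n) * INR (S (S n)) * rho ^ n).
Proof.
  intros Hz Hy.
  assert (Hrho : 0 <= rho) by (eapply Rle_trans; [apply Cmod_ge_0|exact Hz]).
  induction n as [|n IH].
  - replace (y ^ 2 - z ^ 2 - (y - z) * (RtoC (INR 2) * z ^ 1))%C with ((y - z) * (y - z))%C.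
    + rewrite Cmod_mult. simpl. assert (X := Cmod_ge_0 (y - z)%C). nra.
    + simpl. rewrite RtoC_plus. ring.
  - set (e := (y ^ S (S n) - z ^ S (S n) - (y - z) * (RtoC (INR (S (S n))) * z ^ S n))%C) in *.
    replace (y ^ S (S (S n)) - z ^ S (S (S n)) - (y - z) * (RtoC (INR (S (S (S n)))) * z ^ S (S n)))%C
      with (y * e + (y - z) * (y - z) * (RtoC (INR (S (S n))) * z ^ S n))%C.
    + eapply Rle_trans; [apply Cmod_triangle|]. rewrite !Cmod_mult, Cmod_pow, Cmod_R.
      rewrite (Rabs_pos_eq _ (pos_INR _)).
      assert (H1 : Cmod y * Cmod e <= rho * (Cmod (y - z)%C ^ 2 * (INR (S n) * INR (S (S n)) * rho ^ n))).
      { apply Rmult_le_compat; try apply Cmod_ge_0; auto. }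
      assert (H2 : Cmod z ^ S n <= rho ^ S n) by (apply pow_incr; split; [apply Cmod_ge_0|exact Hz]).
      assert (H3 : Cmod (y - z)%C * Cmod (y - z)%C * (INR (S (S n)) * Cmod z ^ S n) <=
        Cmod (y - z)%C ^ 2 * (INR (S (S n)) * rho ^ S n)).
      { replace (Cmod (y - z)%C ^ 2) with (Cmod (y - z)%C * Cmod (y - z)%C) by ring.
        apply Rmult_le_compat_l; [apply Rmult_le_pos; apply Cmod_ge_0|].
        apply Rmult_le_compat_l; [apply pos_INR|exact H2]. }
      eapply Rle_trans; [apply Rplus_le_compat; [exact H1|exact H3]|].
      rewrite (S_INR (S (S n))). rewrite (S_INR (S n)).
      assert (0 <= INR (S n)) by apply pos_INR.
      assert (0 <= Cmod (y - z)%C ^ 2 * rho ^ S n).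
      { apply Rmult_le_pos; [apply pow_le, Cmod_ge_0|apply pow_le; exact Hrho]. }
      replace (rho * (Cmod (y - z)%C ^ 2 * (INR (S n) * (INR (S n) + 1) * rho ^ n)) +
        Cmod (y - z)%C ^ 2 * ((INR (S n) + 1) * rho ^ S n)) with
        ((Cmod (y - z)%C ^ 2 * rho ^ S n) * ((INR (S n) + 1) * (INR (S n) + 1))) by (simpl; ring).
      replace (Cmod (y - z)%C ^ 2 * ((INR (S n) + 1) * (INR (S n) + 1 + 1) * rho ^ S n)) with
        ((Cmod (y - z)%C ^ 2 * rho ^ S n) * ((INR (S n) + 1) * (INR (S n) + 1 + 1))) by ring.
      apply Rmult_le_compat_l; [assumption|nra].
    + unfold e. rewrite (S_INR (S (S n))), RtoC_plus, !Cpow_S. ring.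
Qed.

Lemma ev_derive (a : nat -> C) (r m : R) (z : C) :
  maj a r m -> Cmod z < r -> is_Cderive (ev a) z (ev (der a) z).
Proof.
  intros H Hz. assert (Hz0 := Cmod_ge_0 z).
  set (rho := (Cmod z + r) / 2).
  set (rho' := (rho + r) / 2).
  destruct (maj_der a rho' r m) as [m1 H1]; [unfold rho', rho; lra|exact H|].
  destruct (maj_der (der a) rho rho' m1) as [m2 H2]; [unfold rho', rho; lra|exact H1|].
  apply (is_Cderive_quadratic _ _ _ ((r - Cmod z) / 2) m2); [lra|].
  intros y Hy.
  assert (Hyr : Cmod y <= rho).
  { replace y with (z + (y - z))%C by ring. eapply Rle_trans; [apply Cmod_triangle|].
    unfold rho. lra. }
  assert (Hzr : Cmod z <= rho) by (unfold rho; lra).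
  assert (Cy := ev_clim a r m y H ltac:(unfold rho in *; lra)).
  assert (Cz := ev_clim a r m z H ltac:(lra)).
  assert (Cd := ev_clim (der a) rho' m1 z H1 ltac:(unfold rho', rho; lra)).
  apply (clim_shift _ 1) in Cd.
  assert (CC : clim (fun N => csum (term a y) N + (-(1)) * csum (term a z) N +
      (-(y - z)) * csum (term (der a) z) (N - 1))%C
    (ev a y + (-(1)) * ev a z + (-(y - z)) * ev (der a) z)%C).
  { apply clim_plus; [apply clim_plus|]; auto; apply clim_scal; auto. }
  replace (ev a y - ev a z - (y - z) * ev (der a) z)%C with
    (ev a y + (-(1)) * ev a z + (-(y - z)) * ev (der a) z)%C by ring.
  apply (clim_le _ _ _ CC). intros N.
  set (e := fun n : nat => match n with O => RtoC 0 | S k =>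
     (y ^ S k - z ^ S k - (y - z) * (RtoC (INR (S k)) * z ^ k))%C end).
  replace (csum (term a y) N + (-(1)) * csum (term a z) N +
      (-(y - z)) * csum (term (der a) z) (N - 1))%C with (csum (fun n => a n * e n)%C N).
  - eapply Rle_trans; [apply Cmod_csum|].
    apply Rle_trans with (rsum (fun n => Cmod (y - z)%C ^ 2 *
      match n with S (S k) => Cmod (der (der a) k) * rho ^ k | _ => 0 end) N).
    + apply rsum_le. intros n _. rewrite Cmod_mult. destruct n as [|[|k]].
      * simpl. rewrite Cmod_0. lra.
      * unfold e. replace (y ^ 1 - z ^ 1 - (y - z) * (RtoC (INR 1) * z ^ 0))%C with (RtoC 0)
          by (simpl; ring). rewrite Cmod_0. lra.
      * unfold e, der. rewrite !Cmod_mult, !Cmod_R, !(Rabs_pos_eq _ (pos_INR _)).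
        assert (X := pow_remainder z y rho k Hzr Hyr).
        eapply Rle_trans; [apply Rmult_le_compat_l; [apply Cmod_ge_0|exact X]|].
        apply Req_le. ring.
    + rewrite rsum_scal, Rmult_comm. apply Rmult_le_compat_r; [apply pow_le, Cmod_ge_0|].
      destruct N as [|[|N]].
      * simpl. apply (maj_pos _ _ _ H2).
      * simpl. assert (X := maj_pos _ _ _ H2). lra.
      * rewrite !rsum_shift. rewrite !Rplus_0_l. apply H2.
  - destruct N as [|N]; [simpl; ring|]. rewrite !csum_shift.
    replace (S N - 1)%nat with N by lia.
    rewrite (csum_ext (fun n => a (S n) * e (S n))%C
      (fun n => term a y (S n) + ((-(1)) * term a z (S n) + (-(y - z)) * term (der a) z n))%C).
    + rewrite !csum_plus, !csum_scal. unfold term, e. simpl. ring.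
    + intros n _. unfold term, der, e. ring.
Qed.

(** * Holomorphic functions on the punctured disk *)

(** Two successive derivatives make the first one continuous, as required for
    differentiation under the integral sign, and the condition is stable under
    products. The origin is excluded to admit negative powers. *)
Definition holo (h : C -> C) : Prop :=
  exists D D2 : C -> C, forall z, 0 < Cmod z < 1 ->
    is_Cderive h z (D z) /\ is_Cderive D z (D2 z).

Lemma holo_const (c : C) : holo (fun _ => c).
Proof.
  exists (fun _ => RtoC 0), (fun _ => RtoC 0). intros z _.
  split; apply is_Cderive_const.
Qed.

Lemma holo_id : holo (fun z => z).
Proof.
  exists (fun _ => RtoC 1), (fun _ => RtoC 0). intros z _.
  split; [apply is_Cderive_id|apply is_Cderive_const].
Qed.

Lemma holo_plus (f g : C -> C) : holo f -> holo g -> holo (fun z => f z + g z)%C.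
Proof.
  intros [D [D2 H]] [E [E2 K]].
  exists (fun z => D z + E z)%C, (fun z => D2 z + E2 z)%C. intros z Hz.
  destruct (H z Hz), (K z Hz). split; apply is_Cderive_plus; assumption.
Qed.

Lemma holo_mult (f g : C -> C) : holo f -> holo g -> holo (fun z => f z * g z)%C.
Proof.
  intros [D [D2 H]] [E [E2 K]].
  exists (fun z => D z * g z + f z * E z)%C,
    (fun z => (D2 z * g z + D z * E z) + (D z * E z + f z * E2 z))%C. intros z Hz.
  destruct (H z Hz), (K z Hz). split; [apply is_Cderive_mult; assumption|].
  apply is_Cderive_plus; apply is_Cderive_mult; assumption.
Qed.

Lemma is_Cderive_inv (z : C) : z <> 0 -> is_Cderive Cinv z (- (/ z * / z))%C.
Proof.
  intros Hz. assert (Hm := proj1 (Cmod_gt_0 z) Hz).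
  apply (is_Cderive_quadratic _ _ _ (Cmod z / 2) (2 / Cmod z ^ 3)); [lra|].
  intros y Hy.
  assert (Hy2 : Cmod z / 2 <= Cmod y).
  { assert (Cmod z <= Cmod y + Cmod (y - z)%C); [|lra].
    rewrite <- (Cmod_opp (y - z)%C). eapply Rle_trans; [|apply Cmod_triangle].
    apply Req_le. f_equal. ring. }
  assert (Hy0 : y <> 0) by (apply Cmod_gt_0; lra).
  replace (/ y - / z - (y - z) * - (/ z * / z))%C with ((y - z) * (y - z) * / (y * z * z))%C
    by (field; split; assumption).
  rewrite !Cmod_mult, Cmod_inv by (repeat apply Cmult_neq_0; assumption). rewrite !Cmod_mult.
  rewrite (Rmult_comm (2 / _)). replace (Cmod (y - z)%C ^ 2) with (Cmod (y - z)%C * Cmod (y - z)%C) by ring.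
  apply Rmult_le_compat_l; [apply Rmult_le_pos; apply Cmod_ge_0|].
  replace (2 / Cmod z ^ 3) with (/ (Cmod z / 2 * Cmod z * Cmod z)) by (field; lra).
  apply Rinv_le_contravar.
  - repeat apply Rmult_lt_0_compat; lra.
  - repeat apply Rmult_le_compat_r; lra.
Qed.

Lemma holo_inv : holo Cinv.
Proof.
  exists (fun z => - (/ z * / z))%C,
   (fun z => (-(1)) * (- (/ z * / z) * / z + / z * - (/ z * / z)))%C.
  intros z Hz. assert (Hz0 : z <> 0) by (apply Cmod_gt_0; lra).
  split; [apply is_Cderive_inv; exact Hz0|].
  assert (X := is_Cderive_mult _ _ _ _ _ (is_Cderive_const (-(1)) z)
    (is_Cderive_mult _ _ _ _ _ (is_Cderive_inv z Hz0) (is_Cderive_inv z Hz0))).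
  apply is_Cderive_local with (d := 1) (f := fun y => ((-(1)) * (/ y * / y))%C); [lra|intros; ring|].
  match type of X with is_Cderive _ _ ?l => match goal with |- is_Cderive _ _ ?l' =>
    replace l' with l by ring end end. exact X.
Qed.

Lemma holo_pow (f : C -> C) (n : nat) : holo f -> holo (fun z => f z ^ n)%C.
Proof.
  intros H. induction n as [|n IH]; simpl; [apply holo_const|].
  apply holo_mult; assumption.
Qed.

Lemma analytic_derive_near (f : C -> C) (z : C) :
  analytic_at f z -> exists a d, 0 < d /\
    (forall y, Cmod (y - z)%C < d -> f y = ev a (y - z)%C /\
       is_Cderive f y (ev (der a) (y - z)%C) /\
       is_Cderive (fun y => ev (der a) (y - z)%C) y (ev (der (der a)) (y - z)%C)).
Proof.
  intros [a [e He]].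
  assert (He0 := cond_pos e). set (d := pos e / 2).
  assert (Hexp : forall y, Cmod (y - z)%C < e -> is_Cpseries a (y - z)%C (f y)).
  { intros y Hy. apply He. apply C_NormedModule_mixin_compat1. exact Hy. }
  destruct (maj_of_expansion a (fun y => f (y + z)%C) (pos e) d) as [m Hm].
  { intros y Hy. replace y with (y + z - z)%C at 1 by ring. apply Hexp.
    replace (y + z - z)%C with y by ring. exact Hy. }
  { unfold d; lra. }
  destruct (maj_der a (d / 2) d m) as [m1 Hm1]; [unfold d; lra|exact Hm|].
  exists a, (d / 2). split; [unfold d; lra|].
  assert (Heq : forall y, Cmod (y - z)%C < d -> f y = ev a (y - z)%C).
  { intros y Hy. apply (ev_unique a d m); auto; [lra|]. apply Hexp. unfold d in Hy. lra. }
  assert (Htr : forall y, is_Cderive (fun y => y - z)%C y 1).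
  { intros y. replace (RtoC 1) with (RtoC 1 + RtoC 0)%C by ring.
    apply is_Cderive_plus; [apply is_Cderive_id|apply is_Cderive_const]. }
  intros y Hy. split; [apply Heq; unfold d in *; lra|]. split.
  - apply is_Cderive_local with (f := fun y => ev a (y - z)%C) (d := d / 2); [unfold d; lra| |].
    + intros x Hx. symmetry. apply Heq. replace (x - z)%C with ((x - y) + (y - z))%C by ring.
      eapply Rle_lt_trans; [apply Cmod_triangle|]. unfold d in *; lra.
    + replace (ev (der a) (y - z)%C) with (1 * ev (der a) (y - z))%C by ring.
      apply (is_Cderive_comp (ev a) (fun y => y - z)%C); [|apply Htr].
      apply (ev_derive a d m); auto. unfold d in *; lra.
  - replace (ev (der (der a)) (y - z)%C) with (1 * ev (der (der a)) (y - z))%C by ring.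
    apply (is_Cderive_comp (ev (der a)) (fun y => y - z)%C); [|apply Htr].
    apply (ev_derive (der a) (d / 2) m1); auto.
Qed.

Lemma analytic_holo (f : C -> C) : analytic_on_disk f -> holo f.
Proof.
  intros H. exists (C_derive f), (C_derive (C_derive f)). intros z [_ Hz].
  destruct (analytic_derive_near f z (H z Hz)) as [a [d [Hd Ha]]].
  assert (H0 : Cmod (z - z)%C < d) by (replace (z - z)%C with (RtoC 0) by ring; rewrite Cmod_0; exact Hd).
  assert (E : forall y, Cmod (y - z)%C < d -> ev (der a) (y - z)%C = C_derive f y).
  { intros y Hy. symmetry. apply is_C_derive_unique. apply (Ha y Hy). }
  destruct (Ha z H0) as [_ [H1 H2]]. split.
  - rewrite <- E by exact H0. exact H1.
  - assert (X := is_Cderive_local _ _ _ _ _ Hd E H2).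
    rewrite (is_C_derive_unique _ _ _ X). exact X.
Qed.

(** * Cauchy's theorem for circular means *)

Lemma is_derive_R_eps (f : R -> R) (x l : R) :
  is_derive f x l <-> forall eps, 0 < eps -> exists d, 0 < d /\
    forall y, Rabs (y - x) < d -> Rabs (f y - f x - (y - x) * l) <= eps * Rabs (y - x).
Proof.
  split.
  - intros [_ H] eps He. specialize (H x (fun P HP => HP) (mkposreal _ He)).
    destruct H as [d Hd]. exists d. split; [apply cond_pos|].
    intros y Hy. exact (Hd y Hy).
  - intros H. split; [apply @is_linear_scal_l|].
    intros y Hy eps. apply (@is_filter_lim_locally_unique R_AbsRing R_NormedModule) in Hy.
    subst y. destruct (H eps (cond_pos eps)) as [d [Hd Hy]].
    exists (mkposreal _ Hd). intros y Hb. exact (Hy y Hb).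
Qed.

Lemma is_derive_Re_curve (h : C -> C) (g1 g2 : R -> R) (x : R) (l : C) (d1 d2 : R) :
  is_Cderive h (g1 x, g2 x) l -> is_derive g1 x d1 -> is_derive g2 x d2 ->
  is_derive (fun t => Re (h (g1 t, g2 t))) x (Re (l * (d1, d2))%C).
Proof.
  intros Hh H1 H2. apply is_derive_R_eps. intros eps He.
  apply is_Cderive_eps in Hh. rewrite is_derive_R_eps in H1, H2.
  assert (Hl := Cmod_ge_0 l).
  set (K := Rabs d1 + Rabs d2 + 2). assert (HK : 2 <= K).
  { unfold K. assert (X := Rabs_pos d1). assert (Y := Rabs_pos d2). lra. }
  destruct (Hh (eps / (2 * K))) as [d [Hd Hdh]]; [apply Rdiv_lt_0_compat; lra|].
  set (e1 := Rmin 1 (eps / (4 * (Cmod l + 1)))).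
  assert (He1 : 0 < e1) by (unfold e1; apply Rmin_glb_lt; [lra|apply Rdiv_lt_0_compat; lra]).
  assert (He1' : e1 <= 1) by apply Rmin_l.
  assert (He1'' : e1 * Cmod l <= eps / 4).
  { assert (X : e1 <= eps / (4 * (Cmod l + 1))) by apply Rmin_r.
    apply (Rmult_le_compat_r (Cmod l + 1)) in X; [|lra].
    replace (eps / (4 * (Cmod l + 1)) * (Cmod l + 1)) with (eps / 4) in X by (field; lra). nra. }
  destruct (H1 e1 He1) as [a1 [Ha1 Hb1]]. destruct (H2 e1 He1) as [a2 [Ha2 Hb2]].
  exists (Rmin (Rmin a1 a2) (d / K)). split.
  { repeat apply Rmin_glb_lt; auto. apply Rdiv_lt_0_compat; lra. }
  intros y Hy.
  assert (Hy1 : Rabs (y - x) < a1) by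
    (eapply Rlt_le_trans; [exact Hy|eapply Rle_trans; [apply Rmin_l|apply Rmin_l]]).
  assert (Hy2 : Rabs (y - x) < a2) by
    (eapply Rlt_le_trans; [exact Hy|eapply Rle_trans; [apply Rmin_l|apply Rmin_r]]).
  assert (Hy3 : Rabs (y - x) < d / K) by (eapply Rlt_le_trans; [exact Hy|apply Rmin_r]).
  specialize (Hb1 y Hy1). specialize (Hb2 y Hy2).
  assert (P := Rabs_pos (y - x)).
  set (r := ((g1 y, g2 y) - (g1 x, g2 x) - RtoC (y - x) * (d1, d2))%C).
  assert (Hr : Cmod r <= 2 * e1 * Rabs (y - x)).
  { eapply Rle_trans; [apply Cmod_le_Re_Im|].
    replace (Re r) with (g1 y - g1 x - (y - x) * d1) by (unfold r; simpl; ring).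
    replace (Im r) with (g2 y - g2 x - (y - x) * d2) by (unfold r; simpl; ring). lra. }
  assert (Hc : Cmod ((g1 y, g2 y) - (g1 x, g2 x))%C <= K * Rabs (y - x)).
  { replace ((g1 y, g2 y) - (g1 x, g2 x))%C with (r + RtoC (y - x) * (d1, d2))%C by (unfold r; ring).
    eapply Rle_trans; [apply Cmod_triangle|]. rewrite Cmod_mult, Cmod_R.
    assert (X := Cmod_le_Re_Im (d1, d2)). simpl in X. unfold K. nra. }
  specialize (Hdh (g1 y, g2 y)).
  assert (Hc' : Cmod ((g1 y, g2 y) - (g1 x, g2 x))%C < d).
  { eapply Rle_lt_trans; [exact Hc|].
    apply (Rmult_lt_compat_l K) in Hy3; [|lra].
    replace (K * (d / K)) with d in Hy3 by (field; lra). exact Hy3. }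
  specialize (Hdh Hc').
  set (q := (h (g1 y, g2 y) - h (g1 x, g2 x) - ((g1 y, g2 y) - (g1 x, g2 x)) * l)%C) in *.
  replace (Re (h (g1 y, g2 y)) - Re (h (g1 x, g2 x)) - (y - x) * Re (l * (d1, d2))%C)
    with (Re (q + r * l)%C).
  - eapply Rle_trans; [apply re_le_Cmod|]. eapply Rle_trans; [apply Cmod_triangle|].
    rewrite Cmod_mult.
    assert (X1 : Cmod q <= eps / 2 * Rabs (y - x)).
    { eapply Rle_trans; [exact Hdh|].
      apply Rle_trans with (eps / (2 * K) * (K * Rabs (y - x))).
      - apply Rmult_le_compat_l; [apply Rlt_le, Rdiv_lt_0_compat; lra|exact Hc].
      - apply Req_le. field. lra. }
    assert (X2 : Cmod r * Cmod l <= eps / 2 * Rabs (y - x)).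
    { apply Rle_trans with (2 * e1 * Rabs (y - x) * Cmod l).
      - apply Rmult_le_compat_r; [exact Hl|exact Hr].
      - nra. }
    lra.
  - replace (q + r * l)%C with (h (g1 y, g2 y) - h (g1 x, g2 x) - RtoC (y - x) * (l * (d1, d2)))%C
      by (unfold q, r; ring).
    unfold Re. simpl. ring.
Qed.

Definition circ (r t : R) : C := (r * cos t, r * sin t).

Lemma Cmod_circ (r t : R) : 0 <= r -> Cmod (circ r t) = r.
Proof.
  intros Hr. unfold Cmod, circ; simpl.
  replace (r * cos t * (r * cos t * 1) + r * sin t * (r * sin t * 1)) with (r * r * ((sin t)² + (cos t)²))
    by (unfold Rsqr; ring).
  rewrite sin2_cos2, Rmult_1_r. apply sqrt_square. exact Hr.
Qed.

(** Up to the factor [2 PI], the mean of [Re h]; imaginary parts are reached by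
    multiplying [h] by a constant. *)
Definition mean (h : C -> C) (r : R) : R := RInt (fun t => Re (h (circ r t))) 0 (2 * PI).

Lemma circ_continuous (x y : R) (e : R) : 0 < e ->
  locally_2d (fun u v => Cmod (circ u v - circ x y)%C < e) x y.
Proof.
  intros He. assert (He2 : 0 < e / 2) by lra.
  assert (H1 : continuity_2d_pt (fun u v => u * cos v) x y).
  { apply continuity_2d_pt_mult; [apply continuity_2d_pt_id1|].
    apply (continuity_1d_2d_pt_comp cos (fun _ v => v)); [apply continuity_cos|apply continuity_2d_pt_id2]. }
  assert (H2 : continuity_2d_pt (fun u v => u * sin v) x y).
  { apply continuity_2d_pt_mult; [apply continuity_2d_pt_id1|].
    apply (continuity_1d_2d_pt_comp sin (fun _ v => v)); [apply continuity_sin|apply continuity_2d_pt_id2]. }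
  destruct (H1 (mkposreal _ He2)) as [d1 K1]. destruct (H2 (mkposreal _ He2)) as [d2 K2].
  assert (Hd : 0 < Rmin d1 d2) by (apply Rmin_glb_lt; apply cond_pos).
  exists (mkposreal _ Hd). simpl. intros u v Hu Hv.
  assert (X1 := K1 u v ltac:(eapply Rlt_le_trans; [exact Hu|apply Rmin_l]) ltac:(eapply Rlt_le_trans; [exact Hv|apply Rmin_l])).
  assert (X2 := K2 u v ltac:(eapply Rlt_le_trans; [exact Hu|apply Rmin_r]) ltac:(eapply Rlt_le_trans; [exact Hv|apply Rmin_r])).
  eapply Rle_lt_trans; [apply Cmod_le_Re_Im|]. simpl in *.
  replace (u * cos v + - (x * cos y)) with (u * cos v - x * cos y) by ring.
  replace (u * sin v + - (x * sin y)) with (u * sin v - x * sin y) by ring. lra.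
Qed.

Lemma Re_circ_continuous (h : C -> C) (x y : R) (l : C) :
  is_Cderive h (circ x y) l -> continuity_2d_pt (fun u v => Re (h (circ u v))) x y.
Proof.
  intros H eps. destruct (is_Cderive_continuous _ _ _ H eps (cond_pos eps)) as [d [Hd Hc]].
  destruct (circ_continuous x y d Hd) as [e He]. exists e. intros u v Hu Hv.
  specialize (Hc _ (He u v Hu Hv)). eapply Rle_lt_trans; [|exact Hc].
  eapply Rle_trans; [|apply re_le_Cmod]. apply Req_le. reflexivity.
Qed.

Lemma Re_circ_continuous_1 (h : C -> C) (r t : R) (l : C) :
  is_Cderive h (circ r t) l -> continuous (fun v => Re (h (circ r v))) t.
Proof.
  intros H. apply continuity_pt_filterlim.
  assert (X := Re_circ_continuous h r t l H).
  intros eps He. destruct (X (mkposreal _ He)) as [d Hd]. exists d. split; [apply cond_pos|].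
  intros v [_ Hv]. apply (Hd r v); [|exact Hv].
  rewrite Rminus_diag, Rabs_R0. apply cond_pos.
Qed.

Lemma mean_ex (h : C -> C) (r : R) : holo h -> 0 < r < 1 ->
  ex_RInt (fun t => Re (h (circ r t))) 0 (2 * PI).
Proof.
  intros [D [D2 H]] Hr. apply (@ex_RInt_continuous R_CompleteNormedModule). intros t _.
  apply (Re_circ_continuous_1 _ _ _ (D (circ r t))). apply H.
  rewrite Cmod_circ; lra.
Qed.

(** By the Cauchy-Riemann equations the radial derivative of [Re h] is [1 / r]
    times the angular derivative of [Im h], whose integral over a period
    vanishes. *)
Lemma mean_derive_0 (h : C -> C) (r : R) : holo h -> 0 < r < 1 ->
  is_derive (mean h) r 0.
Proof.
  intros Hh Hr. assert (Hh0 := Hh). destruct Hh as [D [D2 H]].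
  (* r times the radial derivative of h, and also - i times its angular derivative *)
  set (E := fun z => (D z * z)%C).
  assert (HE : forall x t, 0 < x < 1 -> is_Cderive E (circ x t) (D2 (circ x t) * circ x t + D (circ x t) * 1)%C).
  { intros x t Hx. apply is_Cderive_mult; [apply H; rewrite Cmod_circ; lra|apply is_Cderive_id]. }
  assert (Hder : forall x t, 0 < x < 1 ->
    is_derive (fun u => Re (h (circ u t))) x (/ x * Re (E (circ x t)))).
  { intros x t Hx.
    replace (/ x * Re (E (circ x t))) with (Re (D (circ x t) * (cos t, sin t))%C).
    - apply (is_derive_Re_curve h (fun u => u * cos t) (fun u => u * sin t)).
      + apply H. fold (circ x t). rewrite Cmod_circ; lra.
      + auto_derive; [trivial|ring].
      + auto_derive; [trivial|ring].
    - unfold E, circ. simpl. field. lra. }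
  assert (Hnear : forall x, 0 < x < 1 -> exists d : posreal, forall u, Rabs (u - x) < d -> 0 < u < 1).
  { intros x Hx. assert (Hd : 0 < Rmin x (1 - x)) by (apply Rmin_glb_lt; lra).
    exists (mkposreal _ Hd). simpl. intros u Hu.
    assert (X := Rmin_l x (1 - x)). assert (Y := Rmin_r x (1 - x)).
    apply Rabs_def2 in Hu. lra. }
  destruct (Hnear r Hr) as [d Hd].
  assert (Hmain : is_derive (mean h) r (RInt (fun t => Derive (fun u => Re (h (circ u t))) r) 0 (2 * PI))).
  { apply (is_derive_RInt_param (fun u t => Re (h (circ u t)))).
    - exists d. intros u Hu t _. eexists. apply Hder. apply Hd. exact Hu.
    - intros t _. apply continuity_2d_pt_ext_loc with (f := fun u v => / u * Re (E (circ u v))).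
      + exists d. intros u v Hu _. symmetry. apply is_derive_unique. apply Hder. apply Hd. exact Hu.
      + apply continuity_2d_pt_mult.
        * apply continuity_2d_pt_inv; [apply continuity_2d_pt_id1|lra].
        * eapply Re_circ_continuous. apply HE. exact Hr.
    - exists d. intros u Hu. apply mean_ex; [exact Hh0|apply Hd; exact Hu]. }
  replace 0 with (RInt (fun t => Derive (fun u => Re (h (circ u t))) r) 0 (2 * PI)); [exact Hmain|].
  rewrite (RInt_ext _ (fun t => scal (/ r) (Re (E (circ r t))))).
  2:{ intros t _. apply is_derive_unique. apply Hder. exact Hr. }
  assert (HI : is_RInt (fun t => Re (E (circ r t))) 0 (2 * PI)
     (minus (Re ((fun z => - Ci * h z)%C (circ r (2 * PI)))) (Re ((fun z => - Ci * h z)%C (circ r 0))))).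
  { apply (is_RInt_derive (fun t => Re ((fun z => - Ci * h z)%C (circ r t)))).
    - intros t _.
      replace (Re (E (circ r t))) with
        (Re ((0 * h (circ r t) + - Ci * D (circ r t)) * ((- (r * sin t))%R, (r * cos t)%R))%C).
      + apply (is_derive_Re_curve (fun z => - Ci * h z)%C (fun t => r * cos t) (fun t => r * sin t)).
        * apply (is_Cderive_mult (fun _ => - Ci)%C h); [apply is_Cderive_const|].
          apply H. fold (circ r t). rewrite Cmod_circ; lra.
        * auto_derive; [trivial|ring].
        * auto_derive; [trivial|ring].
      + unfold E, circ. simpl. ring.
    - intros t _. eapply Re_circ_continuous_1. apply HE. exact Hr. }
  assert (Ep : circ r (2 * PI) = circ r 0).
  { unfold circ. rewrite cos_2PI, sin_2PI, cos_0, sin_0. reflexivity. }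
  rewrite Ep, minus_eq_zero in HI.
  assert (HS := is_RInt_scal _ _ _ (/ r) _ HI).
  etransitivity; [exact (is_RInt_unique _ _ _ _ HS)|exact (Rmult_0_r (/ r))].
Qed.

Lemma mean_constant (h : C -> C) (r s : R) : holo h -> 0 < r < 1 -> 0 < s < 1 ->
  mean h r = mean h s.
Proof.
  intros H.
  assert (W : forall r s, r < s -> 0 < r < 1 -> 0 < s < 1 -> mean h r = mean h s).
  { intros x y Hxy Hx Hy. apply (@eq_is_derive R_NormedModule); [|exact Hxy].
    intros t Ht. apply mean_derive_0; [exact H|lra]. }
  intros Hr Hs. destruct (Rtotal_order r s) as [L|[L|L]].
  - apply W; assumption.
  - rewrite L; reflexivity.
  - symmetry; apply W; assumption.
Qed.

Lemma RtoC_neq_0 (x : R) : x <> 0 -> RtoC x <> 0.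
Proof. intros H E. apply H, RtoC_inj, E. Qed.

Lemma mean_ext (f g : C -> C) (r : R) : 0 <= r ->
  (forall z, Cmod z = r -> f z = g z) -> mean f r = mean g r.
Proof.
  intros Hr H. apply RInt_ext. intros t _. rewrite H; [reflexivity|].
  apply Cmod_circ; exact Hr.
Qed.

Lemma mean_plus (f g : C -> C) (r : R) : holo f -> holo g -> 0 < r < 1 ->
  mean (fun z => f z + g z)%C r = mean f r + mean g r.
Proof.
  intros Hf Hg Hr.
  apply (RInt_plus (fun t => Re (f (circ r t))) (fun t => Re (g (circ r t))));
  apply mean_ex; assumption.
Qed.

Lemma mean_ge (h : C -> C) (r L : R) : holo h -> 0 < r < 1 ->
  (forall z, Cmod z = r -> L <= Re (h z)) -> 2 * PI * L <= mean h r.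
Proof.
  intros Hh Hr H. assert (HP := PI_RGT_0).
  assert (E : RInt (fun _ => L) 0 (2 * PI) = 2 * PI * L).
  { rewrite RInt_const. unfold scal; simpl. unfold mult; simpl. ring. }
  rewrite <- E. apply RInt_le; [lra|apply ex_RInt_const|apply mean_ex; assumption|].
  intros t _. apply H. apply Cmod_circ. lra.
Qed.

Lemma mean_le (h : C -> C) (r L : R) : holo h -> 0 < r < 1 ->
  (forall z, Cmod z = r -> Re (h z) <= L) -> mean h r <= 2 * PI * L.
Proof.
  intros Hh Hr H. assert (HP := PI_RGT_0).
  assert (E : RInt (fun _ => L) 0 (2 * PI) = 2 * PI * L).
  { rewrite RInt_const. unfold scal; simpl. unfold mult; simpl. ring. }
  rewrite <- E. apply RInt_le; [lra|apply mean_ex; assumption|apply ex_RInt_const|].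
  intros t _. apply H. apply Cmod_circ. lra.
Qed.

Lemma mean_limit (h : C -> C) (c : C) (r : R) : holo h -> 0 < r < 1 ->
  (forall eps, 0 < eps -> exists d, 0 < d /\
     forall z, 0 < Cmod z < d -> Cmod (h z - c)%C < eps) ->
  mean h r = 2 * PI * Re c.
Proof.
  intros Hh Hr H. assert (HP := PI_RGT_0).
  apply Rminus_diag_uniq. apply cond_eq. intros eps He. rewrite Rminus_0_r.
  assert (He' : 0 < eps / (4 * PI)) by (apply Rdiv_lt_0_compat; lra).
  destruct (H _ He') as [d [Hd Hz]].
  assert (Hs : 0 < Rmin (d / 2) (1 / 2)) by (apply Rmin_glb_lt; lra).
  set (s := Rmin (d / 2) (1 / 2)) in *.
  assert (Hs1 : s <= d / 2) by apply Rmin_l. assert (Hs2 : s <= 1 / 2) by apply Rmin_r.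
  rewrite (mean_constant h r s) by (auto; lra).
  assert (Hb : forall z, Cmod z = s -> Rabs (Re (h z) - Re c) <= eps / (4 * PI)).
  { intros z E. apply Rlt_le. eapply Rle_lt_trans; [|apply (Hz z); lra].
    eapply Rle_trans; [|apply re_le_Cmod]. apply Req_le. reflexivity. }
  assert (X := mean_ge h s (Re c - eps / (4 * PI)) Hh ltac:(lra)).
  assert (Y := mean_le h s (Re c + eps / (4 * PI)) Hh ltac:(lra)).
  assert (X' := X (fun z E => ltac:(specialize (Hb z E); apply Rabs_le_between in Hb; lra))).
  assert (Y' := Y (fun z E => ltac:(specialize (Hb z E); apply Rabs_le_between in Hb; lra))).
  replace (2 * PI * (Re c - eps / (4 * PI))) with (2 * PI * Re c - eps / 2) in X' by (field; lra).
  replace (2 * PI * (Re c + eps / (4 * PI))) with (2 * PI * Re c + eps / 2) in Y' by (field; lra).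
  apply Rabs_def1; lra.
Qed.

(** The mean of [z^(-n-1)] is homogeneous of degree [-n-1] in the radius, yet
    constant, hence zero. *)
Lemma mean_pole (c : C) (n : nat) (r : R) : 0 < r < 1 ->
  mean (fun z => c * (/ z) ^ S n)%C r = 0.
Proof.
  intros Hr. set (h := fun z => (c * (/ z) ^ S n)%C).
  assert (Hh : holo h) by (apply holo_mult; [apply holo_const|apply holo_pow, holo_inv]).
  assert (E : mean h (1 / 4) = 2 ^ S n * mean h (1 / 2)).
  { unfold mean.
    assert (X := is_RInt_scal _ _ _ (2 ^ S n) _ (RInt_correct _ _ _ (mean_ex h (1 / 2) Hh ltac:(lra)))).
    apply is_RInt_unique in X. etransitivity; [|exact X].
    apply RInt_ext. intros t _. unfold h.
    assert (Hc : circ (1 / 4) t = (RtoC (1 / 2) * circ (1 / 2) t)%C).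
    { unfold circ, RtoC, Cmult; simpl. f_equal; field. }
    assert (Hnz : circ (1 / 2) t <> 0) by (apply Cmod_gt_0; rewrite Cmod_circ; lra).
    rewrite Hc. replace (/ (RtoC (1 / 2) * circ (1 / 2) t))%C with (RtoC 2 * / circ (1 / 2) t)%C.
    - rewrite Cpow_mult_l, <- RtoC_pow.
      replace (c * (RtoC (2 ^ S n) * (/ circ (1 / 2) t) ^ S n))%C with
        (RtoC (2 ^ S n) * (c * (/ circ (1 / 2) t) ^ S n))%C by ring.
      unfold scal; simpl. unfold mult; simpl. ring.
    - rewrite RtoC_div by lra. field. exact Hnz. }
  rewrite (mean_constant h (1 / 4) (1 / 2)) in E by (auto; lra).
  rewrite (mean_constant h r (1 / 2)) by (auto; lra).
  assert (X : 2 <= 2 ^ S n).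
  { simpl. assert (1 <= 2 ^ n) by (apply pow_R1_Rle; lra). lra. }
  nra.
Qed.

(** Cauchy's coefficient formula.  Splitting off [a_0 / z^(j+1)], which has mean
    zero, replaces [p] by [(p - a_0) / z] and lowers the exponent. *)
Lemma mean_coef (j : nat) (c : C) (p : C -> C) (a : nat -> C) (s m d r : R) :
  holo p -> 0 < s -> 0 < d -> maj a s m ->
  (forall z, 0 < Cmod z < d -> p z = ev a z) -> 0 < r < 1 ->
  mean (fun z => c * p z * (/ z) ^ j)%C r = 2 * PI * Re (c * a j)%C.
Proof.
  intros Hp Hs Hd Ha Hz Hr. revert p a m d Hp Hd Ha Hz.
  induction j as [|j IH]; intros p a m d Hp Hd Ha Hz.
  - apply mean_limit; auto.
    + apply holo_mult; [apply holo_mult; [apply holo_const|exact Hp]|apply (holo_pow Cinv 0), holo_inv].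
    + intros eps He.
      assert (X := is_Cderive_mult _ _ _ _ _ (is_Cderive_const c 0)
         (ev_derive a s m 0 Ha ltac:(rewrite Cmod_0; exact Hs))).
      destruct (is_Cderive_continuous _ _ _ X eps He) as [e [He' Hc]].
      exists (Rmin d e). split; [apply Rmin_glb_lt; assumption|].
      intros z [Hz1 Hz2].
      assert (Hzd : Cmod z < d) by (eapply Rlt_le_trans; [exact Hz2|apply Rmin_l]).
      assert (Hze : Cmod z < e) by (eapply Rlt_le_trans; [exact Hz2|apply Rmin_r]).
      specialize (Hc z). rewrite ev_0 in Hc.
      replace (z - 0)%C with z in Hc by ring. specialize (Hc Hze).
      rewrite Hz by lra. simpl. replace (c * ev a z * 1)%C with (c * ev a z)%C by ring. exact Hc.
  - set (q := fun z => ((p z + - a 0%nat) * / z)%C).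
    assert (Hq : holo q).
    { apply holo_mult; [|apply holo_inv]. apply holo_plus; [exact Hp|apply holo_const]. }
    rewrite (mean_ext _ (fun z => (c * a 0%nat) * (/ z) ^ S j + c * q z * (/ z) ^ j)%C) by
      (try lra; intros z _; unfold q; simpl; ring).
    rewrite mean_plus; auto.
    + rewrite mean_pole by exact Hr. rewrite Rplus_0_l.
      change (a (S j)) with (shift a j).
      apply (IH q (shift a) ((m - Cmod (a 0%nat)) / s) (Rmin d s)); auto.
      * apply Rmin_glb_lt; assumption.
      * apply maj_shift; assumption.
      * intros z [Hz1 Hz2].
        assert (Hzd : Cmod z < d) by (eapply Rlt_le_trans; [exact Hz2|apply Rmin_l]).
        assert (Hzs : Cmod z < s) by (eapply Rlt_le_trans; [exact Hz2|apply Rmin_r]).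
        unfold q. rewrite Hz by lra. rewrite (ev_shift a s m) by (auto; lra).
        field. apply Cmod_gt_0. exact Hz1.
    + apply holo_mult; [apply holo_const|apply holo_pow, holo_inv].
    + apply holo_mult; [|apply holo_pow, holo_inv].
      apply holo_mult; [apply holo_const|exact Hq].
Qed.

Lemma Re_scal (x : R) (v : C) : Re (RtoC x * v)%C = x * Re v.
Proof. destruct v. unfold Re. simpl. ring. Qed.

Lemma Re_kernel (x L : R) (q v : C) :
  Re (RtoC x * q + (q * v - RtoC (2 * L) * v + q * Cconj v))%C =
  x * Re q + 2 * Re v * (Re q - L).
Proof. destruct q, v. unfold Re, Cconj. simpl. ring. Qed.

(** * Caratheodory's inequality *)

(** Integrate [Re p - L] against the nonnegative kernel [r^n + Re (conj c z^n)].
    On the circle [conj z = r^2 / z], so the product is the real part of a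
    function holomorphic outside 0, whose mean is known. *)
Lemma caratheodory_circle (p : C -> C) (a : nat -> C) (s m d r L : R) (j : nat) :
  holo p -> 0 < s -> 0 < d -> maj a s m ->
  (forall z, 0 < Cmod z < d -> p z = ev a z) -> 0 < r < 1 ->
  (forall z, Cmod z = r -> L <= Re (p z)) ->
  Cmod (a (S j)) * r ^ S j <= 2 * (Re (a 0%nat) - L).
Proof.
  intros Hp Hs Hd Ha Hz Hr HL. set (n := S j).
  assert (Hrn : 0 < r ^ n) by (apply pow_lt; lra).
  assert (HP := PI_RGT_0).
  (* c rotates a_n onto the negative real axis *)
  assert (Hc : exists c, Cmod c = 1 /\ Re (c * a n)%C = - Cmod (a n)).
  { destruct (Ceq_dec (a n) 0) as [E|E].
    - exists (RtoC 1). split; [apply Cmod_1|]. rewrite E, Cmod_0. simpl. ring.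
    - assert (Hm := proj1 (Cmod_gt_0 _) E).
      exists (- (Cconj (a n) * / RtoC (Cmod (a n))))%C. split.
      + rewrite Cmod_opp, Cmod_mult, Cmod_conj, Cmod_inv by (apply RtoC_neq_0; lra).
        rewrite Cmod_R, Rabs_pos_eq by lra. field. lra.
      + replace (- (Cconj (a n) * / RtoC (Cmod (a n))) * a n)%C with
          (- ((a n * Cconj (a n)) * / RtoC (Cmod (a n))))%C by ring.
        rewrite <- Cmod2_conj.
        assert (Hk : (RtoC (Cmod (a n) ^ 2) * / RtoC (Cmod (a n)))%C = RtoC (Cmod (a n))).
        { rewrite RtoC_pow. field. apply RtoC_neq_0. lra. }
        rewrite Hk. reflexivity. }
  destruct Hc as [c [Hc1 Hc2]].
  (* the three pieces of the product with twice the kernel *)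
  set (T1 := fun z => (RtoC (2 * r ^ n) * p z * (/ z) ^ 0)%C).
  set (T2 := fun z => (Cconj c * (p z + - RtoC (2 * L)) * z ^ n)%C).
  set (T3 := fun z => ((c * RtoC (r ^ n * r ^ n)) * p z * (/ z) ^ n)%C).
  assert (H1 : holo T1) by (apply holo_mult; [apply holo_mult; [apply holo_const|exact Hp]|apply (holo_pow Cinv 0), holo_inv]).
  assert (H2 : holo T2).
  { apply holo_mult; [|apply holo_pow, holo_id]. apply holo_mult; [apply holo_const|].
    apply holo_plus; [exact Hp|apply holo_const]. }
  assert (H3 : holo T3).
  { apply holo_mult; [|apply holo_pow, holo_inv]. apply holo_mult; [apply holo_const|exact Hp]. }
  assert (M1 : mean T1 r = 2 * PI * Re (RtoC (2 * r ^ n) * a 0%nat)%C)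
    by (apply (mean_coef 0 (RtoC (2 * r ^ n)) p a s m d r); auto).
  assert (M3 : mean T3 r = 2 * PI * Re (c * RtoC (r ^ n * r ^ n) * a n)%C)
    by (apply (mean_coef n (c * RtoC (r ^ n * r ^ n))%C p a s m d r); auto).
  assert (M2 : mean T2 r = 2 * PI * Re (RtoC 0)).
  { apply mean_limit; auto. intros eps He.
    set (B := m + Rabs (2 * L) + 1).
    assert (HB : 0 < B).
    { unfold B. assert (X := maj_pos _ _ _ Ha). assert (Y := Rabs_pos (2 * L)). lra. }
    exists (Rmin (Rmin d s) (Rmin 1 (eps / B))). split.
    { repeat apply Rmin_glb_lt; try assumption; [lra|apply Rdiv_lt_0_compat; lra]. }
    intros z [Hz1 Hz2].
    assert (Hzd : Cmod z < d) by (eapply Rlt_le_trans; [exact Hz2|eapply Rle_trans; [apply Rmin_l|apply Rmin_l]]).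
    assert (Hzs : Cmod z < s) by (eapply Rlt_le_trans; [exact Hz2|eapply Rle_trans; [apply Rmin_l|apply Rmin_r]]).
    assert (Hz1' : Cmod z < 1) by (eapply Rlt_le_trans; [exact Hz2|eapply Rle_trans; [apply Rmin_r|apply Rmin_l]]).
    assert (Hze : Cmod z < eps / B) by (eapply Rlt_le_trans; [exact Hz2|eapply Rle_trans; [apply Rmin_r|apply Rmin_r]]).
    unfold T2. replace (Cconj c * (p z + - RtoC (2 * L)) * z ^ n - 0)%C with
      (Cconj c * (p z + - RtoC (2 * L)) * z ^ n)%C by ring.
    rewrite !Cmod_mult, Cmod_conj, Hc1, Cmod_pow, Rmult_1_l.
    assert (X1 : Cmod (p z + - RtoC (2 * L))%C <= B).
    { eapply Rle_trans; [apply Cmod_triangle|]. rewrite Cmod_opp, Cmod_R, Hz by lra.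
      assert (X := ev_maj _ _ _ z Ha ltac:(lra)). unfold B. lra. }
    assert (X2 : Cmod z ^ n <= Cmod z).
    { unfold n. simpl. rewrite <- (Rmult_1_r (Cmod z)) at 3.
      apply Rmult_le_compat_l; [lra|]. rewrite <- (pow1 j). apply pow_incr. lra. }
    apply (Rmult_lt_compat_l B) in Hze; [|exact HB].
    replace (B * (eps / B)) with eps in Hze by (field; lra).
    eapply Rle_lt_trans; [|exact Hze].
    apply Rmult_le_compat; auto using Cmod_ge_0. apply pow_le, Cmod_ge_0. }
  assert (M : mean (fun z => T1 z + (T2 z + T3 z))%C r =
    2 * PI * (2 * r ^ n * Re (a 0%nat) - r ^ n * r ^ n * Cmod (a n))).
  { rewrite (mean_plus T1 (fun z => T2 z + T3 z)%C) by (auto using holo_plus).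
    rewrite mean_plus by auto. rewrite M1, M2, M3.
    replace (c * RtoC (r ^ n * r ^ n) * a n)%C with (RtoC (r ^ n * r ^ n) * (c * a n))%C by ring.
    rewrite !Re_scal, Hc2. change (Re (RtoC 0)) with 0. ring. }
  assert (G : 2 * PI * (2 * L * r ^ n) <= mean (fun z => T1 z + (T2 z + T3 z))%C r).
  { apply mean_ge; auto using holo_plus. intros z Ez. specialize (HL z Ez).
    assert (Hz0 : z <> 0) by (apply Cmod_gt_0; lra).
    set (v := (Cconj c * z ^ n)%C).
    assert (Hv : Rabs (Re v) <= r ^ n).
    { eapply Rle_trans; [apply re_le_Cmod|]. unfold v.
      rewrite Cmod_mult, Cmod_conj, Hc1, Cmod_pow, Ez. lra. }
    assert (Ev : (c * RtoC (r ^ n * r ^ n) * (/ z) ^ n)%C = Cconj v).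
    { unfold v. rewrite Cmult_conj, Cconj_conj, Cpow_conj, Cpow_inv by exact Hz0.
      assert (Er : RtoC (r ^ n * r ^ n) = (z ^ n * Cconj z ^ n)%C).
      { rewrite <- Cpow_mult_l, <- Cmod2_conj, Ez, <- RtoC_pow. f_equal.
        rewrite <- Rpow_mult_distr. f_equal. ring. }
      rewrite Er. field. apply Cpow_nz. exact Hz0. }
    replace (T1 z + (T2 z + T3 z))%C with
      (RtoC (2 * r ^ n) * p z + (p z * v - RtoC (2 * L) * v + p z * Cconj v))%C.
    - replace (Re (RtoC (2 * r ^ n) * p z + (p z * v - RtoC (2 * L) * v + p z * Cconj v))%C)
        with (2 * r ^ n * Re (p z) + 2 * Re v * (Re (p z) - L)) by
        (symmetry; apply Re_kernel).
      apply Rabs_le_between in Hv. nra.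
    - unfold T1, T2, T3.
      replace (c * RtoC (r ^ n * r ^ n) * p z * (/ z) ^ n)%C with
        (p z * (c * RtoC (r ^ n * r ^ n) * (/ z) ^ n))%C by ring.
      rewrite Ev. unfold v. simpl. ring. }
  rewrite M in G. apply Rmult_le_reg_l in G; [|lra].
  apply (Rmult_le_reg_l (r ^ n)); [exact Hrn|]. lra.
Qed.

Lemma le_of_radii (x y z : R) (n : nat) : 0 <= x ->
  (forall r, 0 < r < 1 -> x * r ^ n <= y * / r + z) -> x <= y + z.
Proof.
  intros Hx H.
  assert (FL : filter_le (at_left 1) (locally 1)).
  { intros P HP. unfold at_left, within. apply filter_imp with (2 := HP). auto. }
  assert (L1 : filterlim (fun r => x * r ^ n) (at_left 1) (locally (x * 1 ^ n))).
  { apply (filterlim_filter_le_1 _ FL).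
    assert (K : ex_derive (fun r => x * r ^ n) 1) by (auto_derive; trivial).
    exact (ex_derive_continuous _ _ K). }
  assert (L2 : filterlim (fun r => y * / r + z) (at_left 1) (locally (y * / 1 + z))).
  { apply (filterlim_filter_le_1 _ FL).
    assert (K : ex_derive (fun r => y * / r + z) 1) by (auto_derive; lra).
    exact (ex_derive_continuous _ _ K). }
  assert (X : Rbar_le (Finite (x * 1 ^ n)) (Finite (y * / 1 + z))).
  { apply (@filterlim_le R (at_left 1) _ (fun r => x * r ^ n) (fun r => y * / r + z)); auto.
    exists (mkposreal 1 Rlt_0_1). intros r Hb Hr1. apply H.
    unfold ball in Hb; simpl in Hb; unfold AbsRing_ball, abs, minus, plus, opp in Hb; simpl in Hb.
    apply Rabs_def2 in Hb. lra. }
  simpl in X. rewrite pow1, Rinv_1 in X. lra.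
Qed.

(** Only the germ at 0 is expanded: the coefficient bounds come from circular
    means, which use analyticity on the disk point by point. *)
Definition taylor (f : C -> C) (a : nat -> C) : Prop :=
  exists s m, 0 < s /\ maj a s m /\ forall z, Cmod z < s -> f z = ev a z.

Lemma taylor_of_expansion (f : C -> C) (a : nat -> C) (d : R) :
  0 < d -> (forall z, Cmod z < d -> is_Cpseries a z (f z)) -> taylor f a.
Proof.
  intros Hd H. destruct (maj_of_expansion a f d (d / 2) H ltac:(lra)) as [m Hm].
  exists (d / 2), m. split; [lra|split; [exact Hm|]]. intros z Hz.
  apply (ev_unique a (d / 2) m); auto; [lra|]. apply H. lra.
Qed.

Lemma analytic_taylor (f : C -> C) : analytic_on_disk f -> exists a, taylor f a.
Proof.
  intros H. destruct (H 0) as [a [e He]].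
  { unfold in_disk. rewrite Cmod_0. lra. }
  exists a. apply (taylor_of_expansion f a e (cond_pos e)). intros z Hz.
  replace z with (z - 0)%C at 1 by ring. apply He.
  apply C_NormedModule_mixin_compat1. change (Cmod (z - 0)%C < e).
  replace (z - 0)%C with z by ring. exact Hz.
Qed.

Lemma caratheodory (p : C -> C) (a : nat -> C) (n : nat) :
  analytic_on_disk p -> taylor p a ->
  (forall z, in_disk z -> 0 < Re (p z)) ->
  Cmod (a (S n)) <= 2 * Re (a 0%nat).
Proof.
  intros Hp [s [m [Hs [Ha Hz]]]] Hre.
  apply Rle_trans with (0 + 2 * Re (a 0%nat)); [|lra].
  apply (le_of_radii _ 0 _ (S n)); [apply Cmod_ge_0|].
  intros r Hr. rewrite Rmult_0_l, Rplus_0_l.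
  replace (Re (a 0%nat)) with (Re (a 0%nat) - 0) by ring.
  apply (caratheodory_circle p a s m s r 0); auto.
  - apply analytic_holo; exact Hp.
  - intros z Hz'. apply Hz. lra.
  - intros z E. apply Rlt_le, Hre. unfold in_disk. lra.
Qed.

(** Apply Caratheodory's inequality to [- om] up to a rotation, where
    [om = w / z]: on the circle of radius [r] its real part is at least [- 1 / r],
    which tends to [- 1]. *)
Lemma schwarz_coef (w : C -> C) (b : nat -> C) (n : nat) :
  analytic_on_disk w -> taylor w b -> w 0 = 0 ->
  (forall z, in_disk z -> in_disk (w z)) ->
  b 0%nat = 0 /\ Cmod (b (S (S n))) <= 2 * (1 - Cmod (b 1%nat)).
Proof.
  intros Hw [s [m [Hs [Hb Hz]]]] H0 Hin.
  assert (Hb0 : b 0%nat = 0).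
  { rewrite <- ev_0, <- Hz; [exact H0|rewrite Cmod_0; exact Hs]. }
  split; [exact Hb0|].
  assert (Hc : exists c, Cmod c = 1 /\ (c * b 1%nat)%C = RtoC (- Cmod (b 1%nat))).
  { destruct (Ceq_dec (b 1%nat) 0) as [E|E].
    - exists (RtoC 1). split; [apply Cmod_1|]. rewrite E, Cmod_0, Ropp_0. ring.
    - assert (Hm := proj1 (Cmod_gt_0 _) E).
      exists (RtoC (- Cmod (b 1%nat)) * / b 1%nat)%C. split.
      + rewrite Cmod_mult, Cmod_inv by exact E. rewrite Cmod_R, Rabs_Ropp, Rabs_pos_eq by lra.
        field. lra.
      + field. exact E. }
  destruct Hc as [c [Hc1 Hc2]].
  set (p := fun z => (c * w z * / z)%C).
  assert (Hbs := maj_shift _ _ _ Hs Hb).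
  assert (Hma : maj (fun k => (c * shift b k)%C) s ((m - Cmod (b 0%nat)) / s)).
  { intros N. eapply Rle_trans; [|apply (Hbs N)]. apply rsum_le. intros k _.
    rewrite Cmod_mult, Hc1. lra. }
  assert (Hcev : forall z, Cmod z < s -> ev (fun k => (c * shift b k)%C) z = (c * ev (shift b) z)%C).
  { intros z Hzs. symmetry. apply (ev_unique _ s _ z _ Hma); [lra|].
    apply is_Cpseries_clim.
    apply clim_ext with (u := fun N => (c * csum (term (shift b) z) N)%C).
    - intros N. rewrite <- csum_scal. apply csum_ext. intros; unfold term; ring.
    - apply clim_scal. eapply ev_clim; [exact Hbs|lra]. }
  assert (X : Cmod (c * b (S (S n)))%C <= 2 + 2 * - Cmod (b 1%nat)).
  { apply (le_of_radii _ 2 _ (S n)); [apply Cmod_ge_0|]. intros r Hr.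
    replace (2 * / r + 2 * - Cmod (b 1%nat)) with
      (2 * (Re (c * shift b 0%nat)%C - - / r)).
    - apply (caratheodory_circle p (fun k => (c * shift b k)%C) s ((m - Cmod (b 0%nat)) / s) s r (- / r) n); auto.
      + apply holo_mult; [|apply holo_inv]. apply holo_mult; [apply holo_const|].
        apply analytic_holo; exact Hw.
      + intros z Hz'. rewrite Hcev by lra. unfold p. rewrite Hz by lra.
        rewrite (ev_shift b s m) by (auto; lra). rewrite Hb0. field.
        apply Cmod_gt_0; lra.
      + intros z E. assert (Hz0 : z <> 0) by (apply Cmod_gt_0; lra).
        assert (Y := re_le_Cmod (p z)). apply Rabs_le_between in Y.
        assert (Z : Cmod (p z) <= / r).
        { unfold p. rewrite !Cmod_mult, Cmod_inv, Hc1, E by exact Hz0.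
          assert (Cmod (w z) < 1) by (apply Hin; unfold in_disk; lra).
          assert (0 < / r) by (apply Rinv_0_lt_compat; lra). nra. }
        lra.
    - unfold shift. rewrite Hc2. simpl. ring. }
  rewrite Cmod_mult, Hc1 in X. lra.
Qed.

(** * Series solutions of linear equations *)

Lemma maj_le (a b : nat -> C) (r m : R) :
  0 <= r -> (forall n, Cmod (a n) <= Cmod (b n)) -> maj b r m -> maj a r m.
Proof.
  intros Hr H Hb N. eapply Rle_trans; [|apply (Hb N)]. apply rsum_le. intros n _.
  apply Rmult_le_compat_r; [apply pow_le; exact Hr|apply H].
Qed.

Lemma maj_ext (a b : nat -> C) (r m : R) :
  (forall n, a n = b n) -> maj a r m -> maj b r m.
Proof.
  intros H Ha N. rewrite (rsum_ext _ (fun n => Cmod (a n) * r ^ n)); [apply Ha|].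
  intros n _. rewrite H. reflexivity.
Qed.

Lemma ev_ext (a b : nat -> C) (z : C) : (forall n, a n = b n) -> ev a z = ev b z.
Proof.
  intros H. unfold ev, term. f_equal; apply Series_ext; intros n; rewrite H; reflexivity.
Qed.

Lemma maj_const_bound (a : nat -> C) (r c : R) :
  0 <= r < 1 -> (forall n, Cmod (a n) <= c) -> maj a r (c / (1 - r)).
Proof.
  intros Hr H N. apply rsum_le_geom; [|exact Hr|].
  - eapply Rle_trans; [apply Cmod_ge_0|apply (H 0%nat)].
  - intros n. apply Rmult_le_compat_r; [apply pow_le; lra|apply H].
Qed.

(** The coefficient [n+1] of a solution of [y' = A y] is determined by the
    coefficients up to [n]. *)
Lemma ode_unique (A y v : nat -> C) :
  y 0%nat = v 0%nat ->
  (forall n, der y n = conv A y n) -> (forall n, der v n = conv A v n) ->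
  forall n, y n = v n.
Proof.
  intros H0 Hy Hv n. induction n as [n IH] using (well_founded_induction Nat.lt_wf_0).
  destruct n as [|n]; [exact H0|].
  assert (E : der y n = der v n).
  { rewrite Hy, Hv. apply csum_ext. intros i Hi. rewrite (IH (n - i)%nat) by lia. reflexivity. }
  unfold der in E. assert (Hn : RtoC (INR (S n)) <> 0).
  { apply RtoC_neq_0, not_0_INR. lia. }
  replace (y (S n)) with (/ RtoC (INR (S n)) * (RtoC (INR (S n)) * y (S n)))%C by (field; exact Hn).
  rewrite E. field. exact Hn.
Qed.

Definition integ (c : nat -> C) (n : nat) : C :=
  match n with O => RtoC 0 | S k => (c k * / RtoC (INR (S k)))%C end.

Lemma der_integ (c : nat -> C) (n : nat) : der (integ c) n = c n.
Proof.
  unfold der, integ. field. apply RtoC_neq_0, not_0_INR. lia.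
Qed.

Definition exp_series (n : nat) : C := RtoC (/ INR (fact n)).

Lemma der_exp_series (n : nat) : der exp_series n = exp_series n.
Proof.
  unfold der, exp_series. rewrite <- RtoC_mult. f_equal.
  rewrite fact_simpl, mult_INR. field.
  split; [apply INR_fact_neq_0|apply not_0_INR; lia].
Qed.

Lemma fact_ge_pow2 (n : nat) : 2 ^ n <= INR (fact (S n)).
Proof.
  induction n as [|n IH]; [simpl; lra|].
  rewrite fact_simpl, mult_INR. simpl pow. apply Rmult_le_compat; try lra.
  - apply pow_le; lra.
  - rewrite S_INR. assert (X := pos_INR (S n)). rewrite S_INR in *.
    assert (Y := pos_INR n). lra.
Qed.

(** This is [exp v <= 1 + 2 v], from [n! >= 2^(n-1)]. *)
Lemma maj_exp_series (v : R) : 0 <= v <= 1 -> maj exp_series v (1 + 2 * v).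
Proof.
  intros Hv N. destruct N as [|N]; [simpl; lra|].
  rewrite rsum_shift. apply Rplus_le_compat.
  - unfold exp_series. simpl. rewrite Cmod_R, Rabs_pos_eq; lra.
  - apply Rle_trans with (v / (1 - 1 / 2)); [|lra].
    apply rsum_le_geom; [lra|lra|]. intros n. unfold exp_series.
    assert (X := fact_ge_pow2 n). assert (P : 0 < 2 ^ n) by (apply pow_lt; lra).
    rewrite Cmod_R, Rabs_pos_eq by (apply Rlt_le, Rinv_0_lt_compat; lra).
    replace (1 / 2) with (/ 2) by lra. rewrite pow_inv by lra.
    assert (Y : v ^ S n <= v).
    { simpl. rewrite <- (Rmult_1_r v) at 3. apply Rmult_le_compat_l; [lra|].
      rewrite <- (pow1 n). apply pow_incr. lra. }
    assert (Z : / INR (fact (S n)) <= / 2 ^ n) by (apply Rinv_le_contravar; assumption).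
    rewrite Rmult_comm. apply Rmult_le_compat; auto.
    + apply pow_le; lra.
    + apply Rlt_le, Rinv_0_lt_compat. lra.
Qed.

(** * Majorant sums as functions of the radius *)

Definition disk_series (a : nat -> C) : Prop := forall r, 0 <= r < 1 -> exists m, maj a r m.

Lemma disk_series_maj (a : nat -> C) (r : R) :
  disk_series a -> 0 <= r < 1 -> maj a r (abs_sum a r).
Proof.
  intros H Hr. destruct (H r Hr) as [m Hm]. apply converges_maj; [lra|].
  apply (maj_converges a r m); [lra|exact Hm].
Qed.

Lemma disk_series_der (a : nat -> C) : disk_series a -> disk_series (der a).
Proof.
  intros H r Hr. destruct (H ((r + 1) / 2)) as [m Hm]; [lra|].
  apply (maj_der a r ((r + 1) / 2) m); [lra|exact Hm].
Qed.

Lemma abs_sum_derive (a : nat -> C) (r : R) :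
  disk_series a -> 0 <= r < 1 -> is_derive (abs_sum a) r (abs_sum (der a) r).
Proof.
  intros H Hr.
  replace (abs_sum (der a) r) with (PSeries (PS_derive (fun n => Cmod (a n))) r).
  - apply is_derive_PSeries. rewrite Rabs_pos_eq by lra.
    destruct (H ((r + 1) / 2)) as [m Hm]; [lra|].
    apply Rbar_lt_le_trans with (Finite ((r + 1) / 2)); [simpl; lra|].
    apply (proj1 (CV_radius_bounded (fun n => Cmod (a n)))). exists m. intros n.
    rewrite Rabs_pos_eq.
    + apply maj_coef; [lra|exact Hm].
    + apply Rmult_le_pos; [apply Cmod_ge_0|apply pow_le; lra].
  - apply PSeries_ext. intros n. unfold PS_derive, der.
    rewrite Cmod_mult, Cmod_R, Rabs_pos_eq by apply pos_INR. reflexivity.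
Qed.

Lemma abs_sum_le (a : nat -> C) (r m : R) : 0 <= r -> maj a r m -> abs_sum a r <= m.
Proof. intros Hr H. apply (maj_converges a r m Hr H). Qed.

Lemma abs_sum_pos (a : nat -> C) (r : R) : disk_series a -> 0 <= r < 1 -> 0 <= abs_sum a r.
Proof. intros H Hr. exact (maj_pos _ _ _ (disk_series_maj a r H Hr)). Qed.

Lemma abs_sum_0 (a : nat -> C) : abs_sum a 0 = Cmod (a 0%nat).
Proof. apply PSeries_0. Qed.

(** * Comparison of the majorants *)

(** Here [psi = 1 + z q], the Schwarz function is [w = z om] with
    [om = shift w], and [F], [G] stand for [f0 / z], [f / z]. *)
Section Comparison.

Variables q w F G : nat -> C.
Hypothesis Hq : forall n, Cmod (q n) <= 2.
Hypothesis Hw0 : w 0%nat = 0.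
Hypothesis Hom : forall n, Cmod (w (S (S n))) <= 2 * (1 - Cmod (w 1%nat)).
Hypothesis HF : disk_series F.
Hypothesis HG : disk_series G.
Hypothesis HF0 : F 0%nat = 1.
Hypothesis HG0 : G 0%nat = 1.
Hypothesis HF' : forall n, der F n = conv q F n.
Hypothesis HG' : forall n, der G n = conv (conv (substitute q w) (shift w)) G n.

Lemma w1_le_1 : Cmod (w 1%nat) <= 1.
Proof. assert (X := Hom 0). assert (Y := Cmod_ge_0 (w 2%nat)). lra. Qed.

(** Bohr's inequality: [|om_0| + 2 (1 - |om_0|) (r + r^2 + ...) <= 1], as the
    geometric sum is at most [1/2] for [r <= 1/3]. *)
Lemma maj_om (r : R) : 0 <= r <= 1 / 3 -> maj (shift w) r 1.
Proof.
  intros Hr N. destruct N as [|N]; [simpl; lra|]. rewrite rsum_shift. unfold shift.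
  assert (X := w1_le_1).
  assert (Y : rsum (fun n => Cmod (w (S (S n))) * r ^ S n) N <= (1 - Cmod (w 1%nat)) * 2 * (1 / 3) / (1 - 1 / 3)).
  { apply rsum_le_geom; [lra|lra|]. intros n. simpl.
    replace ((1 - Cmod (w 1%nat)) * 2 * (1 / 3) * (1 / 3) ^ n) with
      (2 * (1 - Cmod (w 1%nat)) * (1 / 3 * (1 / 3) ^ n)) by ring.
    apply Rmult_le_compat; [apply Cmod_ge_0| |apply Hom|].
    - apply Rmult_le_pos; [lra|apply pow_le; lra].
    - apply Rmult_le_compat; [lra|apply pow_le; lra|lra|apply pow_incr; lra]. }
  replace ((1 - Cmod (w 1%nat)) * 2 * (1 / 3) / (1 - 1 / 3)) with (1 - Cmod (w 1%nat)) in Y by field.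
  rewrite pow_O, Rmult_1_r. lra.
Qed.

Lemma maj_w_of_om (r m : R) : maj (shift w) r m -> 0 <= r -> maj w r (r * m).
Proof.
  intros H Hr N. assert (Hm := maj_pos _ _ _ H).
  destruct N as [|N]; [simpl; apply Rmult_le_pos; assumption|].
  rewrite rsum_shift, Hw0, Cmod_0.
  rewrite (rsum_ext _ (fun n => r * (Cmod (shift w n) * r ^ n))) by (intros; unfold shift; simpl; ring).
  rewrite rsum_scal. assert (X := Rmult_le_compat_l r _ _ Hr (H N)). lra.
Qed.

Lemma maj_w (r : R) : 0 <= r <= 1 / 3 -> maj w r r.
Proof.
  intros Hr. replace r with (r * 1) at 2 by ring.
  apply maj_w_of_om; [apply maj_om; exact Hr|lra].
Qed.

Lemma disk_series_w : disk_series w.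
Proof.
  intros r Hr. exists (2 / (1 - r)). apply maj_const_bound; [exact Hr|].
  assert (X := w1_le_1). assert (Y := Cmod_ge_0 (w 1%nat)).
  intros [|[|n]]; [rewrite Hw0, Cmod_0; lra|lra|]. specialize (Hom n). lra.
Qed.

Lemma disk_series_om : disk_series (shift w).
Proof.
  intros r Hr. exists (2 / (1 - r)). apply maj_const_bound; [exact Hr|].
  assert (X := w1_le_1). assert (Y := Cmod_ge_0 (w 1%nat)).
  intros [|n]; unfold shift; [lra|]. specialize (Hom n). lra.
Qed.

Lemma maj_q (r : R) : 0 <= r <= 1 / 3 -> maj q r 3.
Proof.
  intros Hr. apply maj_weaken with (r := 1 / 3) (m := 2 / (1 - 1 / 3)); [|lra|lra].
  apply maj_const_bound; [lra|exact Hq].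
Qed.

(** The coefficients of [- z om']; the sign is the one in
    [(log R)' = - Q(w) z om']. *)
Let neg_theta_om (n : nat) : C := (RtoC (- INR n) * shift w n)%C.
(** The coefficients of [log R], where [G = F(w) R]. *)
Let log_corr : nat -> C := integ (conv (substitute q w) neg_theta_om).
Let corr : nat -> C := substitute exp_series log_corr.
(** The coefficients [j / (j+1) om_j] of [z om'] integrated termwise and
    divided by [z]. *)
Let avg_om (n : nat) : C := (RtoC (INR n / INR (S n)) * shift w n)%C.

Lemma Cmod_neg_theta_om (n : nat) : Cmod (neg_theta_om n) = INR n * Cmod (shift w n).
Proof. unfold neg_theta_om. rewrite Cmod_mult, Cmod_R, Rabs_Ropp, Rabs_pos_eq by apply pos_INR. reflexivity. Qed.

Lemma Cmod_avg_om (n : nat) : Cmod (avg_om n) = INR n / INR (S n) * Cmod (shift w n).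
Proof.
  unfold avg_om. rewrite Cmod_mult, Cmod_R, Rabs_pos_eq; [reflexivity|].
  apply Rmult_le_pos; [apply pos_INR|apply Rlt_le, Rinv_0_lt_compat, lt_0_INR; lia].
Qed.

Lemma disk_series_neg_theta_om : disk_series neg_theta_om.
Proof.
  intros r Hr. destruct (disk_series_der _ disk_series_w r Hr) as [m Hm].
  exists m. apply (maj_le _ (der w)); [lra| |exact Hm]. intros n. rewrite Cmod_neg_theta_om.
  unfold der. rewrite Cmod_mult, Cmod_R, Rabs_pos_eq by apply pos_INR.
  apply Rmult_le_compat_r; [apply Cmod_ge_0|]. rewrite S_INR. lra.
Qed.

Lemma maj_avg_om (r : R) : 0 <= r <= 1 / 3 -> maj avg_om r (2 * r / (1 - r)).
Proof.
  intros Hr N.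
  assert (Hpos : 0 <= 2 * r / (1 - r)).
  { apply Rmult_le_pos; [lra|apply Rlt_le, Rinv_0_lt_compat; lra]. }
  destruct N as [|N]; [exact Hpos|].
  rewrite rsum_shift, Cmod_avg_om. simpl INR at 1. unfold Rdiv at 1. rewrite !Rmult_0_l, Rplus_0_l.
  apply rsum_le_geom; [lra|lra|]. intros n. rewrite Cmod_avg_om. unfold shift.
  assert (X : INR (S n) / INR (S (S n)) <= 1).
  { assert (P : 0 < INR (S (S n))) by (apply lt_0_INR; lia).
    apply (Rmult_le_reg_r (INR (S (S n)))); [exact P|].
    unfold Rdiv. rewrite Rmult_assoc, Rinv_l by lra. rewrite (S_INR (S n)). lra. }
  assert (X0 : 0 <= INR (S n) / INR (S (S n))).
  { apply Rmult_le_pos; [apply pos_INR|apply Rlt_le, Rinv_0_lt_compat, lt_0_INR; lia]. }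
  assert (Y := Hom n). assert (Y0 := Cmod_ge_0 (w (S (S n)))). assert (Y1 := Cmod_ge_0 (w 1%nat)).
  simpl pow. rewrite <- Rmult_assoc. apply Rmult_le_compat_r; [apply pow_le; lra|].
  apply Rmult_le_compat_r; [lra|]. nra.
Qed.

Lemma maj_avg_om_half (r x : R) : 0 <= r -> maj neg_theta_om r x -> maj avg_om r (x / 2).
Proof.
  intros Hr H N. apply (Rmult_le_reg_l 2); [lra|]. replace (2 * (x / 2)) with x by field.
  eapply Rle_trans; [|apply (H N)]. rewrite <- rsum_scal. apply rsum_le. intros n _.
  rewrite Cmod_avg_om, Cmod_neg_theta_om, <- !Rmult_assoc. apply Rmult_le_compat_r; [apply pow_le; exact Hr|].
  apply Rmult_le_compat_r; [apply Cmod_ge_0|].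
  destruct n as [|n]; [simpl; lra|].
  assert (P : 0 < INR (S (S n))) by (apply lt_0_INR; lia).
  apply (Rmult_le_reg_r (INR (S (S n)))); [exact P|].
  replace (2 * (INR (S n) / INR (S (S n))) * INR (S (S n))) with (2 * INR (S n)) by (field; lra).
  assert (X : 0 <= INR n) by apply pos_INR. rewrite !S_INR in *. nra.
Qed.

(** Integrating the term of degree [i + j] of [Q(w) z om'] divides it by
    [i + j + 1 >= j + 1], which turns [j om_j] into [j / (j+1) om_j].  The
    remaining factor is [r] times the majorant 3 of [Q(w)], at most 1. *)
Lemma maj_log_corr (r v : R) : 0 <= r <= 1 / 3 -> maj avg_om r v -> maj log_corr r v.
Proof.
  intros Hr He N. assert (Hv := maj_pos _ _ _ He).
  destruct N as [|N]; [exact Hv|].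
  rewrite rsum_shift. simpl (Cmod (log_corr 0)). rewrite Cmod_0, Rmult_0_l, Rplus_0_l.
  assert (Hqw : maj (substitute q w) r 3).
  { apply (maj_substitute q w r r); [lra|exact Hw0|apply maj_w; exact Hr|apply maj_q; exact Hr]. }
  assert (X := rsum_conv_le (fun i => Cmod (substitute q w i)) (fun i => Cmod (avg_om i)) r 3 v N
    ltac:(lra) ltac:(intros; apply Cmod_ge_0) ltac:(intros; apply Cmod_ge_0) Hqw He).
  apply Rle_trans with (r * (3 * v)); [|nra].
  eapply Rle_trans; [|apply Rmult_le_compat_l; [lra|exact X]].
  rewrite <- rsum_scal. apply rsum_le. intros n _. unfold log_corr, integ.
  assert (P : 0 < INR (S n)) by (apply lt_0_INR; lia).
  rewrite Cmod_mult, Cmod_inv by (apply RtoC_neq_0; lra). rewrite Cmod_R, Rabs_pos_eq by lra.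
  replace (Cmod (conv (substitute q w) neg_theta_om n) * / INR (S n) * r ^ S n) with
    (r * ((/ INR (S n) * Cmod (conv (substitute q w) neg_theta_om n)) * r ^ n)) by (simpl pow; ring).
  apply Rmult_le_compat_l; [lra|]. apply Rmult_le_compat_r; [apply pow_le; lra|].
  eapply Rle_trans.
  { apply Rmult_le_compat_l; [apply Rlt_le, Rinv_0_lt_compat; exact P|apply Cmod_conv_le]. }
  rewrite <- rsum_scal. apply rsum_le. intros i Hi.
  rewrite Cmod_neg_theta_om, Cmod_avg_om.
  replace (/ INR (S n) * (Cmod (substitute q w i) * (INR (n - i) * Cmod (shift w (n - i))))) with
    (Cmod (substitute q w i) * (INR (n - i) / INR (S n) * Cmod (shift w (n - i)))) by (unfold Rdiv; ring).
  apply Rmult_le_compat_l; [apply Cmod_ge_0|]. apply Rmult_le_compat_r; [apply Cmod_ge_0|].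
  apply Rmult_le_compat_l; [apply pos_INR|]. apply Rinv_le_contravar.
  - apply lt_0_INR; lia.
  - apply le_INR. lia.
Qed.

(** Both bounds on the majorant [v] of [log R] serve here: [v <= 1] for
    [exp v <= 1 + 2 v], and [2 v <= x]. *)
Lemma maj_corr (r x : R) : 0 <= r <= 1 / 3 -> maj neg_theta_om r x -> maj corr r (1 + x).
Proof.
  intros Hr HD. assert (Hx := maj_pos _ _ _ HD).
  assert (He : maj avg_om r (Rmin 1 (x / 2))).
  { intros N. apply Rmin_glb.
    - apply (maj_weaken _ r (2 * r / (1 - r)) r 1); [apply maj_avg_om; exact Hr|lra|].
      apply (Rmult_le_reg_r (1 - r)); [lra|]. field_simplify; lra.
    - apply maj_avg_om_half; [lra|exact HD]. }
  assert (X : 0 <= Rmin 1 (x / 2) <= 1) by (split; [apply Rmin_glb; lra|apply Rmin_l]).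
  assert (Y : Rmin 1 (x / 2) <= x / 2) by apply Rmin_r.
  unfold corr. apply (maj_substitute _ _ r (Rmin 1 (x / 2))); [lra|reflexivity|apply maj_log_corr; auto|].
  apply maj_weaken with (1 := maj_exp_series _ X); lra.
Qed.

Let factored : nat -> C := conv (substitute F w) corr.

Lemma maj_F_third : maj F (1 / 3) (abs_sum F (1 / 3)).
Proof. apply disk_series_maj; [exact HF|lra]. Qed.

(** The radius [1/6] serves for identities between germs: there the majorant of
    [log R] is [2/5 < 1], inside the disk where the exponential series is
    majorized. *)
Lemma majorants_near_0 : exists mF mR mD,
  maj (substitute F w) (1 / 6) mF /\ maj corr (1 / 6) mR /\ maj neg_theta_om (1 / 6) mD /\
  maj w (1 / 6) (1 / 6) /\ maj (shift w) (1 / 6) 1 /\ maj (substitute q w) (1 / 6) 3 /\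
  maj log_corr (1 / 6) (2 / 5).
Proof.
  assert (Hw : maj w (1 / 6) (1 / 6)) by (apply maj_w; lra).
  assert (HD : maj neg_theta_om (1 / 6) (abs_sum neg_theta_om (1 / 6))) by (apply disk_series_maj; [apply disk_series_neg_theta_om|lra]).
  exists (abs_sum F (1 / 6)), (1 + abs_sum neg_theta_om (1 / 6)), (abs_sum neg_theta_om (1 / 6)).
  repeat split; auto.
  - apply (maj_substitute F w (1 / 6) (1 / 6)); auto; [lra|apply disk_series_maj; [exact HF|lra]].
  - apply maj_corr; [lra|exact HD].
  - apply maj_om; lra.
  - apply (maj_substitute q w (1 / 6) (1 / 6)); auto; [lra|apply maj_q; lra].
  - apply maj_log_corr; [lra|]. replace (2 / 5) with (2 * (1 / 6) / (1 - 1 / 6)) by field.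
    apply maj_avg_om; lra.
Qed.

(** The product [F(w) R] solves the equation of [G]: the derivative of [F(w)]
    contributes [Q(w) w'], that of [R] contributes [- Q(w) z om'], and
    [w' - z om' = om]. *)
Lemma G_factor (n : nat) : factored n = G n.
Proof.
  destruct majorants_near_0 as (mF & mR & mD & KF & KR & KD & Kw & Kom & Kq & KN).
  assert (KT : maj factored (1 / 6) (mF * mR)) by (apply maj_conv; auto; lra).
  assert (KA : maj (conv (substitute q w) (shift w)) (1 / 6) (3 * 1)) by (apply maj_conv; auto; lra).
  apply (ode_unique (conv (substitute q w) (shift w))); [|clear n; intros n|exact HG'].
  - assert (E : corr 0%nat = 1).
    { unfold corr, substitute, exp_series. simpl. rewrite Rinv_1. ring. }
    unfold factored, conv, substitute. simpl. rewrite HF0, HG0, E. ring.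
  - destruct (maj_der factored (1 / 7) (1 / 6) _ ltac:(lra) KT) as [mT KT'].
    assert (KAT : maj (conv (conv (substitute q w) (shift w)) factored) (1 / 6) (3 * 1 * (mF * mR)))
      by (apply maj_conv; auto; lra).
    apply (ev_inj _ _ (1 / 7) mT (3 * 1 * (mF * mR)) (1 / 7)); [lra|lra|exact KT'| |].
    { apply maj_weaken with (1 := KAT); lra. }
    intros z [_ Hz].
    apply (is_Cderive_unique (ev factored) z).
    { apply (ev_derive factored (1 / 6) (mF * mR)); [exact KT|lra]. }
    assert (Hwz := ev_maj _ _ _ z Kw ltac:(lra)).
    assert (HNz := ev_maj _ _ _ z KN ltac:(lra)).
    assert (E0 : forall y, Cmod y < 1 / 6 -> ev factored y = (ev F (ev w y) * ev exp_series (ev log_corr y))%C).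
    { intros y Hy. unfold factored. rewrite (ev_conv _ _ (1 / 6) mF mR) by (auto; lra). f_equal.
      - apply (ev_substitute F w (1 / 6) (1 / 6) (abs_sum F (1 / 6))); auto; [|lra].
        apply disk_series_maj; [exact HF|lra].
      - apply (ev_substitute exp_series log_corr (1 / 6) (2 / 5) (1 + 2 * (2 / 5))); auto; [|lra].
        apply maj_exp_series. lra. }
    assert (dF : is_Cderive (fun y => ev F (ev w y)) z (ev (der w) z * ev (der F) (ev w z))%C).
    { apply (is_Cderive_comp (ev F) (ev w)).
      - apply (ev_derive F (1 / 3) _ _ maj_F_third). lra.
      - apply (ev_derive w (1 / 6) _ _ Kw). lra. }
    assert (dR : is_Cderive (fun y => ev exp_series (ev log_corr y)) z
       (ev (der log_corr) z * ev (der exp_series) (ev log_corr z))%C).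
    { apply (is_Cderive_comp (ev exp_series) (ev log_corr)).
      - apply (ev_derive exp_series 1 (1 + 2 * 1)); [apply maj_exp_series; lra|lra].
      - apply (ev_derive log_corr (1 / 6) _ _ KN). lra. }
    assert (dT := is_Cderive_mult _ _ _ _ _ dF dR).
    apply (is_Cderive_local _ (ev factored) z _ (1 / 6 - 1 / 7)) in dT; [|lra|].
    2:{ intros y Hy. symmetry. apply E0.
      replace y with ((y - z) + z)%C by ring.
      eapply Rle_lt_trans; [apply Cmod_triangle|]. lra. }
    match type of dT with is_Cderive _ _ ?l => match goal with |- is_Cderive _ _ ?l' =>
      replace l' with l; [exact dT|] end end.
    rewrite (ev_ext (der exp_series) exp_series _ der_exp_series).
    rewrite (ev_ext (der log_corr) (conv (substitute q w) neg_theta_om)) by (intros; apply der_integ).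
    rewrite (ev_ext (der F) (conv q F) _ HF').
    rewrite (ev_ext (der w) (fun n => shift w n + (-(1)) * neg_theta_om n)%C).
    2:{ intros k. unfold neg_theta_om, der, shift. rewrite S_INR, RtoC_plus, RtoC_opp. ring. }
    rewrite (ev_lin _ _ _ (1 / 6) 1 mD) by (auto; lra).
    rewrite (ev_conv (conv (substitute q w) (shift w)) factored (1 / 6) (3 * 1) (mF * mR)) by (auto; lra).
    rewrite (ev_conv (substitute q w) (shift w) (1 / 6) 3 1) by (auto; lra).
    rewrite (ev_conv (substitute q w) neg_theta_om (1 / 6) 3 mD) by (auto; lra).
    rewrite (ev_conv q F (1 / 6) 3 (abs_sum F (1 / 6))).
    + rewrite (ev_substitute q w (1 / 6) (1 / 6) 3); auto; [|apply maj_q; lra|lra].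
      rewrite E0 by lra. ring.
    + apply maj_q; lra.
    + apply disk_series_maj; [exact HF|lra].
    + exact Hwz.
Qed.

(** [G' = Q(w) om F(w) R] and [Q F = F']. *)
Lemma der_G_factor (n : nat) : der G n = conv (conv (substitute (der F) w) (shift w)) corr n.
Proof.
  destruct majorants_near_0 as (mF & mR & mD & KF & KR & KD & Kw & Kom & Kq & KN).
  assert (KF' : maj (der F) (1 / 6) (abs_sum (der F) (1 / 6))).
  { apply disk_series_maj; [apply disk_series_der, HF|lra]. }
  assert (KFw : maj (substitute (der F) w) (1 / 6) (abs_sum (der F) (1 / 6))).
  { apply (maj_substitute _ w (1 / 6) (1 / 6)); auto. lra. }
  assert (KFwo : maj (conv (substitute (der F) w) (shift w)) (1 / 6) (abs_sum (der F) (1 / 6) * 1))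
    by (apply maj_conv; auto; lra).
  assert (KA : maj (conv (substitute q w) (shift w)) (1 / 6) (3 * 1)) by (apply maj_conv; auto; lra).
  assert (KT : maj factored (1 / 6) (mF * mR)) by (apply maj_conv; auto; lra).
  rewrite HG'. revert n.
  assert (KG : maj G (1 / 6) (mF * mR)) by (apply (maj_ext factored); [apply G_factor|exact KT]).
  apply (ev_inj _ _ (1 / 6) (3 * 1 * (mF * mR)) (abs_sum (der F) (1 / 6) * 1 * mR) (1 / 6)); try lra.
  { apply maj_conv; auto; lra. }
  { apply maj_conv; auto; lra. }
  intros z [_ Hz].
  assert (Hwz := ev_maj _ _ _ z Kw ltac:(lra)).
  rewrite (ev_conv _ G (1 / 6) (3 * 1) (mF * mR)) by (auto; lra).
  rewrite <- (ev_ext factored G z G_factor). unfold factored.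
  rewrite (ev_conv _ corr (1 / 6) mF mR) by (auto; lra).
  rewrite (ev_conv _ corr (1 / 6) (abs_sum (der F) (1 / 6) * 1) mR) by (auto; lra).
  rewrite (ev_conv (substitute q w) (shift w) (1 / 6) 3 1) by (auto; lra).
  rewrite (ev_conv _ (shift w) (1 / 6) (abs_sum (der F) (1 / 6)) 1) by (auto; lra).
  rewrite (ev_substitute (der F) w (1 / 6) (1 / 6) (abs_sum (der F) (1 / 6))) by (auto; lra).
  rewrite (ev_substitute F w (1 / 6) (1 / 6) (abs_sum F (1 / 6))); auto;
    [|apply disk_series_maj; [exact HF|lra]|lra].
  rewrite (ev_substitute q w (1 / 6) (1 / 6) 3); auto; [|apply maj_q; lra|lra].
  rewrite (ev_ext (der F) (conv q F) _ HF').
  rewrite (ev_conv q F (1 / 6) 3 (abs_sum F (1 / 6))).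
  - ring.
  - apply maj_q; lra.
  - apply disk_series_maj; [exact HF|lra].
  - exact Hwz.
Qed.

(** With [mu] and [x] the majorants of [om] and [z om'], the bound
    [F^'(u) mu (1 + x)] for [G^'] is at most [F^'(u) (mu + x)] as [mu <= 1]. *)
Lemma derivative_comparison (r : R) : 0 <= r <= 1 / 3 ->
  abs_sum (der G) r <= abs_sum (der w) r * abs_sum (der F) (abs_sum w r).
Proof.
  intros Hr.
  assert (Kw : maj w r (abs_sum w r)) by (apply disk_series_maj; [apply disk_series_w|lra]).
  assert (Hu := maj_pos _ _ _ Kw).
  assert (Hu1 : abs_sum w r <= r) by (apply abs_sum_le; [lra|apply maj_w; exact Hr]).
  assert (KF : maj (der F) (abs_sum w r) (abs_sum (der F) (abs_sum w r))).
  { apply disk_series_maj; [apply disk_series_der, HF|lra]. }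
  assert (Kom : maj (shift w) r (abs_sum (shift w) r)) by (apply disk_series_maj; [apply disk_series_om|lra]).
  assert (KD : maj neg_theta_om r (abs_sum neg_theta_om r)) by (apply disk_series_maj; [apply disk_series_neg_theta_om|lra]).
  assert (Hmu : abs_sum (shift w) r <= 1) by (apply abs_sum_le; [lra|apply maj_om; exact Hr]).
  assert (Hmu0 := maj_pos _ _ _ Kom). assert (Hx0 := maj_pos _ _ _ KD).
  assert (HF0' := maj_pos _ _ _ KF).
  assert (E : abs_sum (der w) r = abs_sum (shift w) r + abs_sum neg_theta_om r).
  { assert (C1 := proj1 (maj_converges _ r _ ltac:(lra) Kom)).
    assert (C2 := proj1 (maj_converges _ r _ ltac:(lra) KD)).
    apply ex_pseries_R in C1. apply ex_pseries_R in C2.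
    unfold abs_sum, PSeries. rewrite <- Series_plus by assumption. apply Series_ext. intros n.
    rewrite Cmod_neg_theta_om. unfold der, shift. rewrite Cmod_mult, Cmod_R, Rabs_pos_eq, S_INR by apply pos_INR.
    ring. }
  assert (KG : maj (der G) r (abs_sum (der F) (abs_sum w r) * abs_sum (shift w) r * (1 + abs_sum neg_theta_om r))).
  { apply (maj_ext (conv (conv (substitute (der F) w) (shift w)) corr)).
    - intros n. symmetry. apply der_G_factor.
    - apply maj_conv; [lra| |apply maj_corr; auto].
      apply maj_conv; [lra| |exact Kom].
      apply (maj_substitute _ w r (abs_sum w r)); auto. lra. }
  eapply Rle_trans; [apply abs_sum_le; [lra|exact KG]|].
  rewrite E, (Rmult_comm _ (abs_sum (der F) _)), Rmult_assoc.
  apply Rmult_le_compat_l; [exact HF0'|]. nra.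
Qed.

(** [F^(w^(r)) - G^(r)] vanishes at 0 and has nonnegative derivative;
    finally [w^(r) <= r]. *)
Lemma abs_sum_comparison (r : R) : 0 <= r <= 1 / 3 -> abs_sum G r <= abs_sum F r.
Proof.
  intros Hr.
  assert (Hu : forall x, 0 <= x <= 1 / 3 -> 0 <= abs_sum w x <= x).
  { intros x Hx. split; [apply abs_sum_pos; [apply disk_series_w|lra]|].
    apply abs_sum_le; [lra|apply maj_w; exact Hx]. }
  assert (Hd : forall x, 0 <= x <= r -> is_derive (fun x => abs_sum F (abs_sum w x) - abs_sum G x) x
     (abs_sum (der w) x * abs_sum (der F) (abs_sum w x) - abs_sum (der G) x)).
  { intros x Hx. specialize (Hu x ltac:(lra)).
    apply (is_derive_minus (fun x => abs_sum F (abs_sum w x)) (abs_sum G)).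
    - apply (is_derive_comp (abs_sum F) (abs_sum w)); apply abs_sum_derive;
      auto using disk_series_w; lra.
    - apply abs_sum_derive; [exact HG|lra]. }
  assert (K : 0 <= abs_sum F (abs_sum w r) - abs_sum G r).
  { destruct (MVT_gen (fun x => abs_sum F (abs_sum w x) - abs_sum G x) 0 r
      (fun x => abs_sum (der w) x * abs_sum (der F) (abs_sum w x) - abs_sum (der G) x))
      as [c [Hc Hmvt]].
    - rewrite Rmin_left, Rmax_right by lra. intros x Hx. apply Hd. lra.
    - rewrite Rmin_left, Rmax_right by lra. intros x Hx. apply continuity_pt_filterlim.
      apply (ex_derive_continuous (fun x => abs_sum F (abs_sum w x) - abs_sum G x)).
      eexists. apply Hd. exact Hx.
    - rewrite Rmin_left, Rmax_right in Hc by lra.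
      assert (X := derivative_comparison c ltac:(lra)).
      assert (E0 : abs_sum F (abs_sum w 0) - abs_sum G 0 = 0).
      { rewrite (abs_sum_0 w), Hw0, Cmod_0, !abs_sum_0, HF0, HG0. ring. }
      assert (Y : 0 <= (abs_sum (der w) c * abs_sum (der F) (abs_sum w c) - abs_sum (der G) c) * (r - 0)).
      { apply Rmult_le_pos; lra. }
      lra. }
  assert (Z : abs_sum F (abs_sum w r) <= abs_sum F r).
  { specialize (Hu r Hr). apply abs_sum_le; [lra|].
    apply maj_weaken with (r := r) (m := abs_sum F r); [apply disk_series_maj; [exact HF|lra]|lra|lra]. }
  lra.
Qed.

End Comparison.

(** * The two logarithmic derivatives *)

Lemma expansion_disk_series (f : C -> C) (a : nat -> C) :
  expansion_on_disk f a ->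
  disk_series a /\ forall z, in_disk z -> f z = ev a z.
Proof.
  intros H.
  assert (Hd : disk_series a).
  { intros r Hr. apply (maj_of_expansion a f 1 r); [exact H|exact Hr]. }
  split; [exact Hd|]. intros z Hz.
  destruct (Hd (Cmod z)) as [m Hm]; [split; [apply Cmod_ge_0|exact Hz]|].
  apply (ev_unique a (Cmod z) m); [exact Hm|lra|apply H; exact Hz].
Qed.

Lemma RtoC_mult_pair (s : R) (z : C) : (RtoC s * z)%C = (s * fst z, s * snd z).
Proof. destruct z. unfold RtoC, Cmult; simpl. f_equal; ring. Qed.

Lemma is_derive_Re_ray (h : C -> C) (z : C) (s : R) (l : C) :
  is_Cderive h (RtoC s * z)%C l ->
  is_derive (fun s => Re (h (RtoC s * z)%C)) s (Re (l * z)%C).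
Proof.
  intros H. rewrite RtoC_mult_pair in H.
  apply is_derive_ext with (f := fun s => Re (h (s * fst z, s * snd z))).
  { intros t. rewrite RtoC_mult_pair. reflexivity. }
  replace (Re (l * z)%C) with (Re (l * (fst z, snd z))%C) by (destruct z; reflexivity).
  apply (is_derive_Re_curve h (fun s => s * fst z) (fun s => s * snd z)).
  - exact H.
  - auto_derive; [trivial|ring].
  - auto_derive; [trivial|ring].
Qed.

Lemma Im_as_Re (v : C) : Im v = Re (- Ci * v)%C.
Proof. destruct v. unfold Re, Im. simpl. ring. Qed.

Lemma is_derive_Im_ray (h : C -> C) (z : C) (s : R) (l : C) :
  is_Cderive h (RtoC s * z)%C l ->
  is_derive (fun s => Im (h (RtoC s * z)%C)) s (Im (l * z)%C).
Proof.
  intros H.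
  apply is_derive_ext with (f := fun s => Re (- Ci * h (RtoC s * z))%C).
  { intros t. rewrite Im_as_Re. reflexivity. }
  replace (Im (l * z)%C) with (Re ((0 * h (RtoC s * z) + - Ci * l) * z)%C).
  - apply (is_derive_Re_ray (fun y => - Ci * h y)%C).
    apply (is_Cderive_mult (fun _ => - Ci)%C h); [apply is_Cderive_const|exact H].
  - rewrite Im_as_Re. f_equal. ring.
Qed.

Lemma Cmod_ray_le (s : R) (z : C) : 0 <= s <= 1 -> Cmod (RtoC s * z)%C <= Cmod z.
Proof.
  intros Hs. rewrite Cmod_mult, Cmod_R, Rabs_pos_eq by lra. assert (X := Cmod_ge_0 z). nra.
Qed.

(** The fundamental theorem of calculus along the segment from 0 to [z], for the
    real and the imaginary part. *)
Lemma RInt_ray (k : nat -> C) (r m : R) (z : C) :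
  maj k r m -> Cmod z < r ->
  is_RInt (V := C_R_NormedModule) (fun s => ev (der k) (RtoC s * z) * z)%C 0 1 (ev k z - k 0%nat)%C.
Proof.
  intros Hk Hz.
  assert (H1 : forall s, 0 <= s <= 1 -> is_Cderive (ev k) (RtoC s * z)%C (ev (der k) (RtoC s * z)%C)).
  { intros s Hs. apply (ev_derive k r m _ Hk). assert (X := Cmod_ray_le s z Hs). lra. }
  set (r' := (Cmod z + r) / 2). assert (Hz0 := Cmod_ge_0 z).
  destruct (maj_der k r' r m) as [m' Hm']; [unfold r'; lra|exact Hk|].
  assert (H2 : forall s, 0 <= s <= 1 -> is_Cderive (fun y => ev (der k) y * z)%C (RtoC s * z)%C
     (ev (der (der k)) (RtoC s * z) * z + ev (der k) (RtoC s * z) * 0)%C).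
  { intros s Hs. apply is_Cderive_mult; [|apply is_Cderive_const].
    apply (ev_derive (der k) r' m' _ Hm'). assert (X := Cmod_ray_le s z Hs). unfold r'. lra. }
  assert (E1 : ev k (RtoC 1 * z)%C = ev k z) by (f_equal; ring).
  assert (E0 : ev k (RtoC 0 * z)%C = k 0%nat).
  { replace (RtoC 0 * z)%C with (RtoC 0) by ring. apply ev_0. }
  assert (HR : is_RInt (fun s => Re (ev (der k) (RtoC s * z) * z)%C) 0 1
     (minus (Re (ev k (RtoC 1 * z)%C)) (Re (ev k (RtoC 0 * z)%C)))).
  { apply (is_RInt_derive (fun s => Re (ev k (RtoC s * z)%C))
      (fun s => Re (ev (der k) (RtoC s * z) * z)%C) 0 1);
    rewrite Rmin_left, Rmax_right by lra; intros s Hs.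
    - apply is_derive_Re_ray. apply H1. exact Hs.
    - apply (ex_derive_continuous (fun s => Re (ev (der k) (RtoC s * z) * z)%C)).
      eexists. apply (is_derive_Re_ray (fun y => ev (der k) y * z)%C). apply H2. exact Hs. }
  assert (HI : is_RInt (fun s => Im (ev (der k) (RtoC s * z) * z)%C) 0 1
     (minus (Im (ev k (RtoC 1 * z)%C)) (Im (ev k (RtoC 0 * z)%C)))).
  { apply (is_RInt_derive (fun s => Im (ev k (RtoC s * z)%C))
      (fun s => Im (ev (der k) (RtoC s * z) * z)%C) 0 1);
    rewrite Rmin_left, Rmax_right by lra; intros s Hs.
    - apply is_derive_Im_ray. apply H1. exact Hs.
    - apply (ex_derive_continuous (fun s => Im (ev (der k) (RtoC s * z) * z)%C)).
      eexists. apply (is_derive_Im_ray (fun y => ev (der k) y * z)%C). apply H2. exact Hs. }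
  rewrite E1, E0 in HR, HI.
  exact (@is_RInt_fct_extend_pair R_NormedModule R_NormedModule
    (fun s => ev (der k) (RtoC s * z) * z)%C 0 1 _ _ HR HI).
Qed.

Lemma maj_integ (q : nat -> C) (r m : R) : 0 <= r -> maj q r m -> maj (integ q) r (r * m).
Proof.
  intros Hr H. apply (maj_le _ (fun n => match n with O => RtoC 0 | S k => q k end)); [exact Hr| |].
  - intros [|n]; unfold integ; [lra|].
    assert (P : 1 <= INR (S n)) by (rewrite S_INR; assert (X := pos_INR n); lra).
    rewrite Cmod_mult, Cmod_inv by (apply RtoC_neq_0; lra). rewrite Cmod_R, Rabs_pos_eq by lra.
    assert (/ INR (S n) <= 1) by (rewrite <- Rinv_1; apply Rinv_le_contravar; lra).
    assert (X := Cmod_ge_0 (q n)). nra.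
  - apply maj_w_of_om; [reflexivity|exact H|exact Hr].
Qed.

(** With [Q = shift beta] and [K' = Q], the integral in [f0] is [K(z)], so
    [F = exp K].  Both sides are differentiated along the ray through [z], where
    only real derivatives of the exponential and trigonometric functions occur. *)
Lemma f0_ode (psi : C -> C) (beta t : nat -> C) :
  taylor psi beta -> beta 0%nat = 1 ->
  t 0%nat = 0 -> expansion_on_disk (f0 psi) t ->
  forall n, der (shift t) n = conv (shift beta) (shift t) n.
Proof.
  intros [s [m [Hs [Hb Hpsi]]]] Hb0 Ht0 Ht.
  destruct (expansion_disk_series _ _ Ht) as [Dt Et].
  set (r := Rmin s (1 / 2)).
  assert (Hr : 0 < r) by (unfold r; apply Rmin_glb_lt; lra).
  assert (Hrs : r <= s) by apply Rmin_l. assert (Hr2 : r <= 1 / 2) by apply Rmin_r.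
  assert (Kb : maj beta r m) by (apply maj_weaken with (1 := Hb); lra).
  set (q := shift beta). assert (Kq := maj_shift _ _ _ Hr Kb). fold q in Kq.
  set (mq := (m - Cmod (beta 0%nat)) / r) in *.
  set (K := integ q). assert (KK : maj K r (r * mq)) by (apply maj_integ; [lra|exact Kq]).
  set (F := shift t).
  assert (Kt : maj t r (abs_sum t r)) by (apply disk_series_maj; [exact Dt|lra]).
  assert (KF := maj_shift _ _ _ Hr Kt). fold F in KF.
  set (mF := (abs_sum t r - Cmod (t 0%nat)) / r) in *.
  assert (EF : forall z, 0 < Cmod z < r -> ev F z = Cexp (ev K z)).
  { intros z Hz. assert (Hz0 : z <> 0) by (apply Cmod_gt_0; lra).
    assert (E : (z * ev F z)%C = (z * Cexp (ev K z))%C).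
    { transitivity (f0 psi z).
      - rewrite Et by (unfold in_disk; lra).
        rewrite (ev_shift t r _ z Hr Kt) by lra. rewrite Ht0. fold F. ring.
      - unfold f0. do 2 f_equal. apply (@is_RInt_unique C_R_CompleteNormedModule).
        assert (X := RInt_ray K r _ z KK ltac:(lra)).
        replace (ev K z - K 0%nat)%C with (ev K z) in X by (unfold K; simpl; ring).
        apply (is_RInt_ext (V := C_R_NormedModule)) with (2 := X).
        intros x Hx. rewrite Rmin_left, Rmax_right in Hx by lra.
        rewrite (ev_ext (der K) q) by (intros; apply der_integ).
        assert (Y := Cmod_ray_le x z ltac:(lra)).
        assert (Hx0 : (RtoC x * z)%C <> 0) by (apply Cmult_neq_0; [apply RtoC_neq_0; lra|exact Hz0]).
        rewrite Hpsi by lra. rewrite (ev_shift beta r m _ Hr Kb) by lra. rewrite Hb0. fold q.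
        match goal with |- ?u = ?v => change (@eq C u v) end.
        field. split; [exact Hz0|apply RtoC_neq_0; lra]. }
    replace (ev F z) with (/ z * (z * ev F z))%C by (field; exact Hz0).
    rewrite E. field. exact Hz0. }
  destruct (maj_der F (r / 2) r mF ltac:(lra) KF) as [mF' KF'].
  assert (KqF : maj (conv q F) (r / 2) (mq * mF)).
  { apply maj_conv; [lra| |].
    - apply maj_weaken with (1 := Kq); lra.
    - apply maj_weaken with (1 := KF); lra. }
  apply (ev_inj _ _ (r / 2) mF' (mq * mF) (r / 2)); try lra; auto.
  intros z Hz.
  assert (Hz0 : z <> 0) by (apply Cmod_gt_0; lra).
  rewrite (ev_conv q F r mq mF) by (auto; lra).
  assert (E1 : (RtoC 1 * z)%C = z) by ring.
  assert (dF : is_Cderive (ev F) (RtoC 1 * z)%C (ev (der F) z)).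
  { rewrite E1. apply (ev_derive F r mF); [exact KF|lra]. }
  assert (dK : is_Cderive (ev K) (RtoC 1 * z)%C (ev q z)).
  { rewrite E1, <- (ev_ext (der K) q) by (intros; apply der_integ).
    apply (ev_derive K r (r * mq)); [exact KK|lra]. }
  assert (Hloc : locally 1 (fun x => ev F (RtoC x * z)%C = Cexp (ev K (RtoC x * z)%C))).
  { exists (mkposreal (1 / 2) ltac:(lra)). intros x Hx. apply EF.
    unfold ball in Hx; simpl in Hx; unfold AbsRing_ball, abs, minus, plus, opp in Hx; simpl in Hx.
    apply Rabs_def2 in Hx. rewrite Cmod_mult, Cmod_R, Rabs_pos_eq by lra. nra. }
  set (k1 := fun x => Re (ev K (RtoC x * z)%C)). set (k2 := fun x => Im (ev K (RtoC x * z)%C)).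
  assert (d1 : is_derive k1 1 (Re (ev q z * z)%C)) by (apply is_derive_Re_ray; exact dK).
  assert (d2 : is_derive k2 1 (Im (ev q z * z)%C)) by (apply is_derive_Im_ray; exact dK).
  assert (Ek : ev F z = (exp (k1 1) * cos (k2 1), exp (k1 1) * sin (k2 1))).
  { rewrite EF by lra. unfold Cexp, k1, k2. rewrite E1. reflexivity. }
  assert (R1 : Re (ev (der F) z * z)%C = Re (ev q z * ev F z * z)%C).
  { assert (A := is_derive_Re_ray (ev F) z 1 _ dF).
    assert (B : is_derive (fun x => exp (k1 x) * cos (k2 x)) 1
      (Re (ev q z * z)%C * exp (k1 1) * cos (k2 1) + exp (k1 1) * (Im (ev q z * z)%C * - sin (k2 1)))).
    { apply (Derive.is_derive_mult (fun x => exp (k1 x)) (fun x => cos (k2 x)) 1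
        (Re (ev q z * z)%C * exp (k1 1)) (Im (ev q z * z)%C * - sin (k2 1))).
      - apply (is_derive_comp exp k1); [apply is_derive_exp|exact d1].
      - apply (is_derive_comp cos k2); [apply is_derive_cos|exact d2]. }
    apply (is_derive_ext_loc _ (fun x => exp (k1 x) * cos (k2 x))) in A.
    - rewrite <- (is_derive_unique _ _ _ A), (is_derive_unique _ _ _ B), Ek.
      replace (ev q z * ((exp (k1 1) * cos (k2 1))%R, (exp (k1 1) * sin (k2 1))%R) * z)%C with
        ((ev q z * z) * ((exp (k1 1) * cos (k2 1))%R, (exp (k1 1) * sin (k2 1))%R))%C by ring.
      generalize (ev q z * z)%C. intros [u v]. unfold Re, Im. simpl. ring.
    - apply filter_imp with (2 := Hloc). intros x E. rewrite E. reflexivity. }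
  assert (R2 : Im (ev (der F) z * z)%C = Im (ev q z * ev F z * z)%C).
  { assert (A := is_derive_Im_ray (ev F) z 1 _ dF).
    assert (B : is_derive (fun x => exp (k1 x) * sin (k2 x)) 1
      (Re (ev q z * z)%C * exp (k1 1) * sin (k2 1) + exp (k1 1) * (Im (ev q z * z)%C * cos (k2 1)))).
    { apply (Derive.is_derive_mult (fun x => exp (k1 x)) (fun x => sin (k2 x)) 1
        (Re (ev q z * z)%C * exp (k1 1)) (Im (ev q z * z)%C * cos (k2 1))).
      - apply (is_derive_comp exp k1); [apply is_derive_exp|exact d1].
      - apply (is_derive_comp sin k2); [apply is_derive_sin|exact d2]. }
    apply (is_derive_ext_loc _ (fun x => exp (k1 x) * sin (k2 x))) in A.
    - rewrite <- (is_derive_unique _ _ _ A), (is_derive_unique _ _ _ B), Ek.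
      replace (ev q z * ((exp (k1 1) * cos (k2 1))%R, (exp (k1 1) * sin (k2 1))%R) * z)%C with
        ((ev q z * z) * ((exp (k1 1) * cos (k2 1))%R, (exp (k1 1) * sin (k2 1))%R))%C by ring.
      generalize (ev q z * z)%C. intros [u v]. unfold Re, Im. simpl. ring.
    - apply filter_imp with (2 := Hloc). intros x E. rewrite E. reflexivity. }
  assert (RR : (ev (der F) z * z)%C = (ev q z * ev F z * z)%C).
  { rewrite (surjective_pairing (ev (der F) z * z)%C), (surjective_pairing (ev q z * ev F z * z)%C).
    f_equal; [exact R1|exact R2]. }
  replace (ev (der F) z) with (ev (der F) z * z * / z)%C by (field; exact Hz0).
  rewrite RR. field. exact Hz0.
Qed.

(** [f = z G] turns [z f' / f = 1 + w Q(w)] into [z G' = w Q(w) G] with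
    [w = z om]. *)
Lemma starlike_ode (psi f w : C -> C) (beta a wc : nat -> C) :
  taylor psi beta -> beta 0%nat = 1 -> (forall z, in_disk z -> 0 < Re (psi z)) ->
  taylor w wc -> wc 0%nat = 0 -> (forall n, Cmod (wc (S (S n))) <= 2 * (1 - Cmod (wc 1%nat))) ->
  (forall z, in_disk z -> in_disk (w z)) ->
  a 0%nat = 0 -> expansion_on_disk f a ->
  (forall z, in_disk z -> zdlog f z = psi (w z)) ->
  forall n, der (shift a) n = conv (conv (substitute (shift beta) wc) (shift wc)) (shift a) n.
Proof.
  intros [s [m [Hs [Hb Hpsi]]]] Hb0 Hre [s' [m' [Hs' [_ Hw]]]] Hw0 Hom Hin Ha0 Ha Hlog.
  destruct (expansion_disk_series _ _ Ha) as [Da Ea].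
  set (r := Rmin (Rmin s s') (1 / 3)).
  assert (Hr : 0 < r) by (unfold r; repeat apply Rmin_glb_lt; lra).
  assert (Hrs : r <= s) by (unfold r; eapply Rle_trans; [apply Rmin_l|apply Rmin_l]).
  assert (Hrs' : r <= s') by (unfold r; eapply Rle_trans; [apply Rmin_l|apply Rmin_r]).
  assert (Hr3 : r <= 1 / 3) by apply Rmin_r.
  assert (Kb : maj beta r m) by (apply maj_weaken with (1 := Hb); lra).
  assert (Kq := maj_shift _ _ _ Hr Kb). set (mq := (m - Cmod (beta 0%nat)) / r) in *.
  assert (Kw : maj wc r r) by (apply maj_w; auto; lra).
  assert (Kom : maj (shift wc) r 1) by (apply maj_om; auto; lra).
  assert (Ka : maj a r (abs_sum a r)) by (apply disk_series_maj; [exact Da|lra]).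
  set (G := shift a). assert (KG := maj_shift _ _ _ Hr Ka). fold G in KG.
  set (mG := (abs_sum a r - Cmod (a 0%nat)) / r) in *.
  assert (Kqw : maj (substitute (shift beta) wc) r mq) by (apply (maj_substitute _ wc r r); auto; lra).
  assert (KA : maj (conv (substitute (shift beta) wc) (shift wc)) r (mq * 1)) by (apply maj_conv; auto; lra).
  destruct (maj_der G (r / 2) r mG ltac:(lra) KG) as [mG' KG'].
  assert (KAG : maj (conv (conv (substitute (shift beta) wc) (shift wc)) G) r (mq * 1 * mG))
    by (apply maj_conv; auto; lra).
  apply (ev_inj _ _ (r / 2) mG' (mq * 1 * mG) (r / 2)); try lra; auto.
  { apply maj_weaken with (1 := KAG); lra. }
  intros z Hz. assert (Hz0 : z <> 0) by (apply Cmod_gt_0; lra).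
  assert (Hzd : in_disk z) by (unfold in_disk; lra).
  rewrite (ev_conv _ G r (mq * 1) mG) by (auto; lra).
  rewrite (ev_conv _ (shift wc) r mq 1) by (auto; lra).
  rewrite (ev_substitute _ wc r r mq) by (auto; lra).
  assert (Hwz : Cmod (ev wc z) <= Cmod z).
  { apply (ev_maj wc (Cmod z)); [apply maj_w; auto; lra|lra]. }
  assert (Ef : forall y, Cmod y < r -> f y = (y * ev G y)%C).
  { intros y Hy. rewrite Ea by (unfold in_disk; lra). rewrite (ev_shift a r _ y Hr Ka) by lra.
    rewrite Ha0. fold G. ring. }
  assert (df : C_derive f z = (1 * ev G z + z * ev (der G) z)%C).
  { apply is_C_derive_unique.
    apply (is_Cderive_local (fun y => y * ev G y)%C f z _ (r / 2)); [lra| |].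
    - intros y Hy. symmetry. apply Ef. replace y with ((y - z) + z)%C by ring.
      eapply Rle_lt_trans; [apply Cmod_triangle|]. lra.
    - apply is_Cderive_mult; [apply is_Cderive_id|].
      apply (ev_derive G r mG); [exact KG|lra]. }
  assert (Hl := Hlog z Hzd). assert (Hp := Hre (w z) (Hin z Hzd)).
  unfold zdlog in Hl. destruct (Ceq_dec z 0) as [E|_]; [contradiction|].
  (* at a zero of f the quotient would be 0, but psi has positive real part *)
  assert (Hf0 : f z <> 0).
  { intros E. rewrite <- Hl, E in Hp.
    replace (z * C_derive f z / 0)%C with (RtoC 0) in Hp; [simpl in Hp; lra|].
    unfold Cdiv. replace (/ 0)%C with (RtoC 0); [ring|].
    unfold Cinv, RtoC, Rdiv. simpl. f_equal; ring. }
  rewrite Hw in Hl by lra.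
  rewrite Hpsi in Hl by lra. rewrite (ev_shift beta r m _ Hr Kb), Hb0 in Hl by lra.
  rewrite (ev_shift wc r r z Hr Kw), Hw0 in Hl by lra.
  rewrite df in Hl. rewrite (ev_shift wc r r z Hr Kw), Hw0 by lra.
  set (W := ev (shift wc) z) in *. set (Q := ev (shift beta) (0 + z * W)%C) in *.
  assert (Hl2 : (z * (1 * ev G z + z * ev (der G) z))%C = ((1 + (0 + z * W) * Q) * f z)%C).
  { rewrite <- Hl. field. exact Hf0. }
  rewrite Ef in Hl2 by lra.
  replace (ev (der G) z) with (/ z * / z * (z * (1 * ev G z + z * ev (der G) z) - z * ev G z))%C
    by (field; exact Hz0).
  rewrite Hl2. field. exact Hz0.
Qed.

(** * Bohr's phenomenon *)

(** The coefficients of [g = f o w] are those of the formal composition, and the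
    majorant of the Schwarz function [w] at [r <= 1/3] is at most [r]. *)
Lemma maj_subordinate (f g : C -> C) (a b : nat -> C) (r : R) :
  expansion_on_disk f a -> expansion_on_disk g b -> subordinate g f ->
  0 <= r <= 1 / 3 -> maj b r (abs_sum a r).
Proof.
  intros Ha Hb [w [Hw [Hw0 [Hin Hgf]]]] Hr.
  destruct (expansion_disk_series _ _ Ha) as [Da Ea].
  destruct (expansion_disk_series _ _ Hb) as [Db Eb].
  destruct (analytic_taylor w Hw) as [wc Hwc].
  assert (Hom := fun n => proj2 (schwarz_coef w wc n Hw Hwc Hw0 Hin)).
  assert (Hwc0 := proj1 (schwarz_coef w wc 0 Hw Hwc Hw0 Hin)).
  destruct Hwc as [s [m [Hs [_ Ew]]]].
  assert (Kw : forall x, 0 <= x <= 1 / 3 -> maj wc x x) by (intros; apply maj_w; auto).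
  assert (Ka : forall x, 0 <= x <= 1 / 3 -> maj a x (abs_sum a x)).
  { intros x Hx. apply disk_series_maj; [exact Da|lra]. }
  apply (maj_ext (substitute a wc)).
  2:{ apply (maj_substitute a wc r r); auto. lra. }
  set (d := Rmin s (1 / 3)).
  assert (Hd : 0 < d) by (apply Rmin_glb_lt; lra).
  assert (Hd1 : d <= s) by apply Rmin_l. assert (Hd2 : d <= 1 / 3) by apply Rmin_r.
  assert (Ka3 := Ka (1 / 3) ltac:(lra)). assert (Kw3 := Kw (1 / 3) ltac:(lra)).
  apply (ev_inj _ _ (1 / 3) (abs_sum a (1 / 3)) (abs_sum b (1 / 3)) d); auto; [lra| | |].
  - apply (maj_substitute a wc (1 / 3) (1 / 3)); auto. lra.
  - apply disk_series_maj; [exact Db|lra].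
  - intros z Hz. assert (Hzd : in_disk z) by (unfold in_disk; lra).
    rewrite (ev_substitute a wc (1 / 3) (1 / 3) (abs_sum a (1 / 3))) by (auto; lra).
    rewrite <- (Eb z Hzd), (Hgf z Hzd), (Ea (w z) (Hin z Hzd)), (Ew z) by lra. reflexivity.
Qed.

Lemma maj_starlike (psi f : C -> C) (t a : nat -> C) (r : R) :
  ma_minda psi -> t 0%nat = 0 -> t 1%nat = 1 -> expansion_on_disk (f0 psi) t ->
  subordinate (zdlog f) psi -> a 0%nat = 0 -> a 1%nat = 1 -> expansion_on_disk f a ->
  0 <= r <= 1 / 3 -> abs_sum a r <= abs_sum t r.
Proof.
  intros (Hpsi & _ & Hre & Hpsi0 & _) Ht0 Ht1 Ht (w & Hw & Hw0 & Hin & Hlog) Ha0 Ha1 Ha Hr.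
  destruct (expansion_disk_series _ _ Ha) as [Da _].
  destruct (expansion_disk_series _ _ Ht) as [Dt _].
  destruct (analytic_taylor psi Hpsi) as [beta Hbeta].
  destruct (analytic_taylor w Hw) as [wc Hwc].
  assert (Hom := fun n => proj2 (schwarz_coef w wc n Hw Hwc Hw0 Hin)).
  assert (Hwc0 := proj1 (schwarz_coef w wc 0 Hw Hwc Hw0 Hin)).
  assert (Hb0 : beta 0%nat = 1).
  { destruct Hbeta as [s [m [Hs [_ E]]]].
    rewrite <- ev_0, <- E; [exact Hpsi0|rewrite Cmod_0; exact Hs]. }
  assert (Hq : forall n, Cmod (shift beta n) <= 2).
  { intros n. assert (X := caratheodory psi beta n Hpsi Hbeta Hre). rewrite Hb0 in X.
    unfold shift. simpl in X. lra. }
  assert (Hdisk : forall c, disk_series c -> disk_series (shift c)).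
  { intros c Hc x Hx. destruct (Hc ((x + 1) / 2)) as [m Hm]; [lra|].
    exists ((m - Cmod (c 0%nat)) / ((x + 1) / 2)).
    apply (maj_weaken _ ((x + 1) / 2) ((m - Cmod (c 0%nat)) / ((x + 1) / 2)));
      [apply maj_shift; [lra|exact Hm]|lra|lra]. }
  assert (Main : abs_sum (shift a) r <= abs_sum (shift t) r).
  { apply (abs_sum_comparison (shift beta) wc (shift t) (shift a)); auto.
    - apply (f0_ode psi); auto.
    - apply (starlike_ode psi f w); auto. }
  destruct (Req_dec r 0) as [E0|E0].
  { rewrite E0, !abs_sum_0, Ha0, Ht0. lra. }
  apply Rle_trans with (r * abs_sum (shift a) r).
  - apply abs_sum_le; [lra|]. apply maj_w_of_om; [exact Ha0| |lra].
    apply disk_series_maj; [apply Hdisk, Da|lra].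
  - apply Rle_trans with (r * abs_sum (shift t) r); [apply Rmult_le_compat_l; lra|].
    assert (X := maj_shift t r _ ltac:(lra) (disk_series_maj t r Dt ltac:(lra))).
    apply abs_sum_le in X; [|lra]. rewrite Ht0, Cmod_0 in X.
    apply (Rmult_le_compat_l r) in X; [|lra].
    replace (r * ((abs_sum t r - 0) / r)) with (abs_sum t r) in X by (field; exact E0). exact X.
Qed.

(** A boundary point is a limit of points outside the set. *)
Lemma koebe_le_dist (Omega : C -> Prop) (rho : R) :
  (forall w, Cmod w < rho -> Omega w) ->
  Rbar_le (Finite rho) (dist_to_boundary 0 Omega).
Proof.
  intros H. apply (proj2 (Glb_Rbar_correct (fun d => exists w, boundary Omega w /\ d = Cmod (w - 0)%C))).
  intros d [w [Hw Hd]]. simpl. subst d. apply Rnot_lt_le. intros Hlt.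
  replace (w - 0)%C with w in Hlt by ring.
  destruct (Hw (rho - Cmod w) ltac:(lra)) as [_ [u [Hu Hud]]].
  apply Hu, H. replace u with ((u - w) + w)%C by ring.
  eapply Rle_lt_trans; [apply Cmod_triangle|]. lra.
Qed.

Theorem theorem5p1 (psi : C -> C) (rstar r0 : R) (t : nat -> C)
  (f g : C -> C) (b : nat -> C)
  (Hpsi : ma_minda psi)
  (Hrstar : is_koebe_radius psi rstar)
  (Ht0 : t 0%nat = RtoC 0)
  (Ht1 : t 1%nat = RtoC 1)
  (Ht : expansion_on_disk (f0 psi) t)
  (Hr0 : is_least_positive_root t rstar r0)
  (Hf : S_star psi f)
  (Hg : S_sub f g)
  (Hb0 : b 0%nat = RtoC 0)
  (Hb : expansion_on_disk g b) :
  forall (z : C) (r : R), Cmod z = r -> (r <= Rmin r0 (1 / 3))%R ->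
    converges_abs b r /\
    Rbar_le (Finite (abs_sum b r))
            (dist_to_boundary (f (RtoC 0)) (image_disk f)).
Proof.
  intros z r Hz Hr.
  assert (Hr' : 0 <= r <= 1 / 3).
  { split; [rewrite <- Hz; apply Cmod_ge_0|]. eapply Rle_trans; [exact Hr|apply Rmin_r]. }
  assert (Hrr0 : r <= r0) by (eapply Rle_trans; [exact Hr|apply Rmin_l]).
  destruct Hf as [HfA Hfsub]. assert (HA := HfA).
  destruct HA as [_ [a [Ha0 [Ha1 Ha]]]].
  destruct Hg as [_ [_ Hgf]].
  assert (Kb := maj_subordinate f g a b r Ha Hb Hgf Hr').
  destruct (maj_converges b r _ (proj1 Hr') Kb) as [Hc Hle].
  split; [exact Hc|].
  assert (Hat := maj_starlike psi f t a r Hpsi Ht0 Ht1 Ht Hfsub Ha0 Ha1 Ha Hr').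
  destruct Hr0 as [[Hr0pos [Hr0c Hr0v]] _].
  assert (Htr : abs_sum t r <= rstar).
  { rewrite <- Hr0v. apply abs_sum_le; [lra|].
    apply maj_weaken with (r := r0) (m := abs_sum t r0); [|lra|lra].
    apply converges_maj; [lra|exact Hr0c]. }
  apply Rbar_le_trans with (Finite rstar); [simpl; lra|].
  destruct (expansion_disk_series _ _ Ha) as [_ Ea].
  rewrite Ea, ev_0, Ha0 by (unfold in_disk; rewrite Cmod_0; lra).
  apply koebe_le_dist. apply (proj1 Hrstar). split; assumption.
Qed.
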